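(* $\mathcal{D}(\mathbb{D})\subset\mathrm{VMOSH}(\mathbb{D})$, i.e. every function in the Dirichlet space of slice hyperholomorphic functions on $\mathbb{D}$ belongs to $\mathrm{VMOSH}(\mathbb{D})$.
   Context: Let $\mathbb{H}$ be the quaternions, $\mathbb{S}=\{x\in\mathbb{H}:\mathrm{Re}(x)=0,|x|=1\}$, $\mathbb{C}_i=\{x_0+ix_1:x_0,x_1\in\mathbb{R}\}$ for $i\in\mathbb{S}$, $\mathbb{D}$ the open unit ball of $\mathbb{H}$, $\mathbb{D}_i=\mathbb{D}\cap\mathbb{C}_i$. Every $x\in\mathbb{H}$ is written $x=x_0+i_xx_1$ with $x_0=\mathrm{Re}(x)$, $x_1=|\mathrm{Im}(x)|\ge 0$, $i_x\in\mathbb{S}$. A real differentiable $f:\mathbb{D}\to\mathbb{H}$ is (left) slice hyperholomorphic, $f\in\mathcal{SH}_L(\mathbb{D})$, if $f(x)=\alpha(x_0,x_1)+i_x\beta(x_0,x_1)$ for all $x\in\mathbb{D}$, where the $\mathbb{H}$-valued functions $\alpha,\beta$ satisfy $\alpha(x_0,-x_1)=\alpha(x_0,x_1)$, $\beta(x_0,-x_1)=-\beta(x_0,x_1)$, $\partial_{x_0}\alpha=\partial_{x_1}\beta$, $\partial_{x_0}\beta=-\partial_{x_1}\alpha$. The slice derivative of such $f$ is $\partial_Sf(s)=\lim_{\mathbb{C}_{i_s}\ni p\to s}(p-s)^{-1}(f(p)-f(s))=\frac{\partial}{\partial s_0}f(s)$. The Dirichlet space $\mathcal{D}(\mathbb{D})$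 is the set of $f\in\mathcal{SH}_L(\mathbb{D})$ with $\sup_{i\in\mathbb{S}}\int_{\mathbb{D}_i}|\partial_Sf(s)|^2\,d\lambda_2(s)<\infty$, where $\lambda_2$ is two-dimensional Lebesgue measure on $\mathbb{C}_i$. $\mathcal{H}^2(\mathbb{D})$ is the set of $f\in\mathcal{SH}_L(\mathbb{D})$ with $\sup_{i\in\mathbb{S}}\lim_{r\nearrow1}\frac1{2\pi}\int_0^{2\pi}|f(re^{i\theta})|^2\,d\theta<\infty$; boundary values $f(e^{i\theta})$ are radial limits (existing for almost every $\theta$). For $f\in\mathcal{H}^2(\mathbb{D})$, $i\in\mathbb{S}$ and a bounded open interval $I\subset\mathbb{R}$ with length $|I|\le2\pi$, let $f_{I,i}=\frac1{|I|}\int_If(e^{i\theta})\,d\theta$. $\mathrm{BMOSH}(\mathbb{D})$ is the set of $f\in\mathcal{H}^2(\mathbb{D})$ with $\sup_{i\in\mathbb{S}}\sup_{|I|\le2\pi}\frac1{|I|}\int_I|f(e^{i\theta})-f_{I,i}|^2\,d\theta<\infty$. $\mathrm{VMOSH}(\mathbb{D})$ is the set of $f\in\mathrm{BMOSH}(\mathbb{D})$ such that $\lim_{|I|\to0}\frac1{|I|}\int_I|f(e^{i\theta})-f_{I,i}|^2\,d\theta=0$ (uniformly over intervals $I\subset\mathbb{R}$ of length $|I|$) for all $i\in\mathbb{S}$. *)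

(* Defs.v *)
From HB Require Import structures.
From mathcomp Require Import all_boot all_order all_algebra.
From mathcomp Require Import all_classical all_reals all_analysis.
Import Order.TTheory GRing.Theory Num.Theory.
Import numFieldNormedType.Exports.

Set Implicit Arguments.
Unset Strict Implicit.
Unset Printing Implicit Defensive.

Local Open Scope classical_set_scope.
Local Open Scope ring_scope.

(* The quaternion x_0 + x_1 i + x_2 j + x_3 k is the row vector of its
   coordinates, which provides the real vector space structure, the topology
   and (real) differentiability.  Pitfall: the library norm `|x| on row vectors
   is the max norm; the quaternionic modulus is [qabs]. *)
Notation quaternion R := 'rV[R]_4.

Section Quaternions.
Context {R : realType}.
Implicit Types (x y s : quaternion R) (u v t : R).

Definition quat (a b c d : R) : quaternion R :=
  \row_(k < 4) [:: a; b; c; d]`_k.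

Definition qone : quaternion R := quat 1 0 0 0.

Definition qmul x y : quaternion R :=
  let x0 := x 0 0 in let x1 := x 0 1 in
  let x2 := x 0 2%:R in let x3 := x 0 3%:R in
  let y0 := y 0 0 in let y1 := y 0 1 in
  let y2 := y 0 2%:R in let y3 := y 0 3%:R in
  quat (x0 * y0 - x1 * y1 - x2 * y2 - x3 * y3)
       (x0 * y1 + x1 * y0 + x2 * y3 - x3 * y2)
       (x0 * y2 - x1 * y3 + x2 * y0 + x3 * y1)
       (x0 * y3 + x1 * y2 - x2 * y1 + x3 * y0).

Definition qRe x : R := x 0 0.

Definition qIm x : quaternion R := x - qRe x *: qone.

Definition qconj x : quaternion R := qRe x *: qone - qIm x.

Definition qabs x : R := Num.sqrt (\sum_(k < 4) x 0 k ^+ 2).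

Definition qinv x : quaternion R := (qabs x ^+ 2)^-1 *: qconj x.

Definition im_sphere : set (quaternion R) :=
  [set i | qRe i = 0 /\ qabs i = 1].

Definition unit_ball : set (quaternion R) := [set x | qabs x < 1].

Definition unit_disc : set (R * R) := [set z | z.1 ^+ 2 + z.2 ^+ 2 < 1].

Definition slice_point (i : quaternion R) u v : quaternion R :=
  u *: qone + v *: i.

Definition slice (i : quaternion R) : set (quaternion R) :=
  [set x | exists u v, x = slice_point i u v].

(* The unit i_x of x = x_0 + i_x x_1 with x_1 = |Im x|.  It is not determined
   when x is real; we then fix i_x := i. *)
Definition im_unit x : quaternion R :=
  if qIm x == 0 then quat 0 1 0 0 else (qabs (qIm x))^-1 *: qIm x.

Definition qexp (i : quaternion R) t : quaternion R :=
  slice_point i (cos t) (sin t).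

End Quaternions.

Section SliceHyperholomorphic.
Context {R : realType}.
Implicit Types (f : quaternion R -> quaternion R) (i s : quaternion R).

(* Functions on the unit ball are total functions of which only the values on
   [unit_ball] are ever used. *)
Definition SH_L : set (quaternion R -> quaternion R) := [set f |
  (forall x, unit_ball x -> differentiable f x) /\
  exists alpha beta : R -> R -> quaternion R,
    (forall x, unit_ball x ->
       f x = alpha (qRe x) (qabs (qIm x))
             + qmul (im_unit x) (beta (qRe x) (qabs (qIm x)))) /\
    (forall u v, unit_disc (u, v) ->
       [/\ alpha u (- v) = alpha u v, beta u (- v) = - beta u v,
           [/\ derivable (alpha ^~ v) u 1, derivable (alpha u) v 1,
               derivable (beta ^~ v) u 1 & derivable (beta u) v 1],
           'D_1 (alpha ^~ v) u = 'D_1 (beta u) v &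
           'D_1 (beta ^~ v) u = - 'D_1 (alpha u) v])].

Definition slice_derivative f s : quaternion R :=
  lim (qmul (qinv (p - s)) (f p - f s)
         @[p --> within (slice (im_unit s)) s^']).

Definition dirichlet_integral f i : \bar R :=
  (\int[lebesgue_measure \x lebesgue_measure]_(z in unit_disc)
     (qabs (slice_derivative f (slice_point i z.1 z.2)) ^+ 2)%:E)%E.

Definition Dirichlet : set (quaternion R -> quaternion R) := [set f |
  SH_L f /\ (ereal_sup [set dirichlet_integral f i | i in im_sphere] < +oo)%E].

Definition integral_mean f i (r : R) : \bar R :=
  (((2 * pi)^-1)%:E *
   \int[lebesgue_measure]_(t in `[0%R, (2 * pi)%R])
     (qabs (f (r *: qexp i t)) ^+ 2)%:E)%E.

(* Existence of the limits is made explicit since [lim] is total. *)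
Definition Hardy2 : set (quaternion R -> quaternion R) := [set f |
  [/\ SH_L f,
      forall i, im_sphere i -> cvg (integral_mean f i r @[r --> 1^'-]) &
      (ereal_sup [set lim (integral_mean f i r @[r --> 1^'-]) | i in im_sphere]
         < +oo)%E]].

(* Radial limit f(e^{it}); for f in [Hardy2] it exists for almost every t, so
   that the default value of [lim] is taken only on a null set. *)
Definition boundary_value f i (t : R) : quaternion R :=
  lim (f (r *: qexp i t) @[r --> 1^'-]).

(* f_{I,i} for I = ]a, b[, integrated coordinatewise. *)
Definition boundary_mean f i (a b : R) : quaternion R :=
  (b - a)^-1 *: \row_(k < 4)
    \int[lebesgue_measure]_(t in `]a, b[) (boundary_value f i t 0 k).

Definition mean_oscillation f i (a b : R) : \bar R :=
  (((b - a)^-1)%:E *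
   \int[lebesgue_measure]_(t in `]a, b[)
     (qabs (boundary_value f i t - boundary_mean f i a b) ^+ 2)%:E)%E.

Definition BMOSH : set (quaternion R -> quaternion R) := [set f |
  Hardy2 f /\
  (ereal_sup [set ereal_sup [set mean_oscillation f i I.1 I.2 |
                I in [set I : R * R | (I.1 < I.2)%R /\ (I.2 - I.1 <= 2 * pi)%R]]
     | i in im_sphere] < +oo)%E].

Definition VMOSH : set (quaternion R -> quaternion R) := [set f |
  BMOSH f /\
  forall i, im_sphere i -> forall e : R, 0 < e ->
    exists2 d : R, 0 < d &
      forall a b : R, a < b -> b - a <= 2 * pi -> b - a < d ->
        (mean_oscillation f i a b < e%:E)%E].

End SliceHyperholomorphic.

(* Main.v *)
Require Import Defs.
From mathcomp Require Import all_boot all_order all_algebra.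
From mathcomp Require Import all_classical all_reals all_analysis.
From mathcomp Require Import measurable_realfun ring lra.
Import Order.TTheory GRing.Theory Num.Theory.
Import numFieldNormedType.Exports.

Set Implicit Arguments.
Unset Strict Implicit.
Unset Printing Implicit Defensive.

Local Open Scope classical_set_scope.
Local Open Scope ring_scope.

(** No function theory is needed beyond [|d_r f|, |d_t f| <= |d_S f|] in polar
    coordinates [r e^{it}] ([0 < r < 1]) of a slice, which the Cauchy-Riemann
    equations give; the statement then is the trace embedding of [W^{1,2}] into
    VMO, coordinate by coordinate.  By Cauchy-Schwarz along a radius,
    [|f(e^{it}) - f(r e^{it})|^2 <= (1 - s) X_s(t)] for [s < r < 1], where
    [X_s(t)] is the integral of [|d_S f(r e^{it})|^2] over [s < r < 1].  For an
    arc [I] of length [l] take [1 - s = l / (4 pi)]: some circle of radius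
    [r > s] carries an angular energy over [I] of at most [1 / (1 - s)] times
    the energy of the box, so that [f(r e^{it})] oscillates on [I] by at most a
    multiple of the energy of the annulus [s < |z| < 1], and so does the trace.
    This energy is bounded, which gives BMO, and tends to [0] with [l], which
    gives VMO.  The same radial estimate dominates [|f(r e^{it})|^2], hence the
    convergence of the Hardy means. *)

(** * A fundamental theorem of calculus for merely integrable derivatives *)

(** [SH_L] grants differentiability at each point but no continuity of the derivatives. Along a
    radius or a circle these are only known to be dominated by a measurable function, itself a
    pointwise limit of difference quotients; this dictates the form of the fundamental theorem
    below, an inequality under pointwise differentiability. Polar coordinates enter only through an
    upper bound with a lossy constant. The Jacobian is replaced by two one-dimensional maps that
    expand distances: [t -> r cos t] at fixed [r], then [r -> sqrt (r^2 - u^2)] at fixed [u]. The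
    choice [1 - s = l / (4 pi)] does two things. Since [l <= 2 pi], it keeps [s >= 1/2], away from
    the origin, where area does not control [dr dt]. Being proportional to [l], it balances the two
    errors in the mean over the arc: the radial one carries the factor [(1 - s) / l], the angular
    one [l / (1 - s)], and both are constants. As [lim] is total, boundary values are arbitrary
    where the radial limit fails to exist; off a null set they are exchanged for the measurable
    function [trace]. *)

Section ftc_inequality.
Context {R : realType}.
Notation mu := (@lebesgue_measure R).

Lemma le_lebesgue (A B : set R) : measurable A -> measurable B -> A `<=` B ->
  (mu A <= mu B)%E.
Proof. by move=> mA mB AB; apply: le_measure; rewrite ?inE. Qed.

(** As in the Vitali-Caratheodory theorem, [Phi] is locally bounded below by
    more than [phi x]: it sums the constants [n.+1 * e] over open neighbourhoods
    of the level sets of [phi]. *)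
Lemma lower_majorant (phi : R -> R) (a b eps : R) : a <= b -> 0 < eps ->
  measurable_fun `[a, b] phi -> (forall x, a <= x <= b -> 0 <= phi x) ->
  exists Phi : R -> \bar R,
    [/\ measurable_fun setT Phi, (forall x, 0 <= Phi x)%E,
        (\int[mu]_(x in `[a, b]) Phi x <=
           \int[mu]_(x in `[a, b]) (phi x)%:E + eps%:E)%E &
        forall x, a <= x <= b -> exists2 c, phi x < c &
          \forall y \near x, (c%:E <= Phi y)%E].
Proof.
move=> ab eps0 mphi phi0.
(* The budget [eps] is split as [e * (b - a) + e]: the first part pays for rounding [phi] up to a
   multiple of [e], the second for the neighbourhoods of the level sets. The [+ 1] also keeps the
   denominator positive when [a = b]. *)
pose e := eps / (b - a + 1).
have ba1 : 0 < b - a + 1 by rewrite ltr_wpDl ?subr_ge0.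
have e0 : 0 < e by rewrite divr_gt0.
pose E n := `[a, b] `&` phi @^-1` `[n%:R * e, n.+1%:R * e[.
have mE n : measurable (E n) by exact: mphi.
have Efin n : (mu (E n) < +oo)%E.
  apply: (@le_lt_trans _ _ (mu `[a, b])).
    by apply: le_lebesgue => //; exact: subIsetl.
  by rewrite lebesgue_measure_itv/=; case: ifP => _; rewrite -?EFinB ltry.
(* Excess measure allowed around [E n]: at height [n.+1 * e] it costs [e / 2 ^ n.+1], which sums to
   [e]. *)
pose d n := (e / (2 ^ n.+1)%:R) / (n.+1%:R * e).
have c0 n : 0 < n.+1%:R * e by rewrite mulr_gt0.
have d0 n : 0 < d n by rewrite !divr_gt0// ltr0n expn_gt0.
have /choice [V VP] : (forall n, exists U : set R,
    [/\ open U, E n `<=` U & (mu (U `\` E n) < (d n)%:E)%E]).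
  by move=> n; exact: (lebesgue_regularity_outer (mE n) (Efin n) (d0 n)).
have mV n : measurable (V n) by apply: open_measurable; case: (VP n).
pose Phi x := (\sum_(n <oo) ((n.+1%:R * e)%:E * (\1_(V n) x)%:E))%E.
have t0 n x : (0 <= (n.+1%:R * e)%:E * (\1_(V n) x)%:E)%E.
  by rewrite mule_ge0// lee_fin// ltW.
have mt n : measurable_fun setT
    (fun x => ((n.+1%:R * e)%:E * (\1_(V n) x)%:E)%E : \bar R).
  by apply: measurable_funeM; exact/measurable_EFinP.
have mi n D : measurable_fun D (fun x : R => (\1_(V n) x)%:E).
  by apply/measurable_EFinP; exact: measurable_indic.
exists Phi; split.
- by apply: ge0_emeasurable_sum => // n x _ _; exact: t0.
- by move=> x; apply: nneseries_ge0 => n _ _; exact: t0.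
- have mtI n : measurable_fun `[a, b]
      (fun x => ((n.+1%:R * e)%:E * (\1_(V n) x)%:E)%E : \bar R).
    exact: measurable_funTS.
  rewrite integral_nneseries//.
  apply: (@le_trans _ _ (\sum_(n <oo) (\int[mu]_(x in E n) ((phi x)%:E + e%:E)
     + (e / (2 ^ n.+1)%:R)%:E))%E).
    apply: lee_nneseries => [n _ _|n _].
      by apply: integral_ge0 => x _; exact: t0.
    rewrite ge0_integralZl//; [|exact: mi|by rewrite lee_fin ltW].
    rewrite integral_indic//; last exact: mV.
    apply: (@le_trans _ _ ((n.+1%:R * e)%:E * (mu (E n) + (d n)%:E))%E).
      apply: lee_wpmul2l; first by rewrite lee_fin ltW.
      have -> : V n = E n `|` (V n `\` E n) by rewrite setDUK//; case: (VP n).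
      apply: (@le_trans _ _ (mu (E n `|` (V n `\` E n)))).
        have mU : measurable (E n `|` (V n `\` E n)).
           by apply: measurableU => //; exact: measurableD.
        by apply: le_lebesgue => //; exact: measurableI.
      have hU := @measureU2 _ _ _ mu _ _ (mE n) (measurableD (mV n) (mE n)).
      apply: (le_trans hU).
      by rewrite leeD2l// ltW//; case: (VP n).
    rewrite ge0_muleDr//; last by rewrite lee_fin ltW.
    apply: leeD; last by rewrite -EFinM /d mulrC divfK// gt_eqF.
    rewrite -(integral_cst mu (mE n)).
    apply: ge0_le_integral => //.
    + exact: mE.
    + by move=> x _; rewrite /= lee_fin ltW.
    + apply: emeasurable_funD => //; apply/measurable_EFinP.
      by apply: measurable_funS mphi => // x [].
    + move=> x [_ /=]; rewrite in_itv/= => /andP[h _].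
      by rewrite -EFinD lee_fin -(natr1 n) mulrDl mul1r lerD2r.
  apply: le_trans (epsilon_trick _ _ _) _ => //; [|by rewrite ltW|].
    move=> n; apply: integral_ge0 => x [/=]; rewrite in_itv/= => xab _.
    by rewrite -EFinD lee_fin addr_ge0 ?phi0// ltW.
  have tE : trivIset setT E.
    apply: ltn_trivIset => m n mn; rewrite -subset0 => x [[/= _ +] [/= _ +]].
    rewrite !in_itv/= => /andP[h1 h2] /andP[h3 h4].
    have := le_lt_trans h3 h2.
    by rewrite ltr_pM2r// ltr_nat ltnS leqNgt mn.
  rewrite -ge0_integral_bigcup//; last 2 first.
  + apply: emeasurable_funD => //; apply/measurable_EFinP.
    apply: measurable_funS mphi => //; apply: bigcup_sub => k _; exact: subIsetl.
  + move=> x [n _ [/=]]; rewrite in_itv/= => xab _.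
    by rewrite -EFinD lee_fin addr_ge0 ?phi0// ltW.
  apply: (@le_trans _ _ (\int[mu]_(x in `[a, b]) ((phi x)%:E + e%:E) + e%:E)%E).
    rewrite leeD2r//; apply: ge0_subset_integral => //.
    + have mUE : measurable (\bigcup_k E k) by exact: bigcupT_measurable.
      exact: mUE.
    + apply: emeasurable_funD => //; exact/measurable_EFinP.
    + move=> x; rewrite /= in_itv/= => xab.
      by rewrite -EFinD lee_fin addr_ge0 ?phi0// ltW.
    + apply: bigcup_sub => k _; exact: subIsetl.
  rewrite ge0_integralD//; last 2 first.
  + exact/measurable_EFinP.
  + by move=> x _; rewrite lee_fin ltW.
  rewrite integral_cst// -addeA leeD2l//.
  have muab : mu `[a, b] = (b - a)%:E.
    rewrite lebesgue_measure_itv/= lte_fin; case: ltP => // ba.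
    by rewrite (@le_anti _ _ a b) ?subrr// ab ba.
  rewrite [X in (_ * X + _)%E]muab -EFinM -EFinD lee_fin.
  by rewrite -{2}(mulr1 e) -mulrDr /e divfK// gt_eqF.
(* [x] lies in the level set [E n], so the single term of index [n] already exceeds [phi x], on the
   whole open set [V n]. *)
- move=> x xab; pose n := Num.truncn (phi x / e).
  have Enx : E n x.
    split => /=; rewrite in_itv//=.
    have /andP[h1 h2] : n%:R <= phi x / e < n.+1%:R.
       by apply: truncn_itv; rewrite divr_ge0 ?phi0// ltW.
    by rewrite -ler_pdivlMr// h1 -ltr_pdivrMr.
  exists (n.+1%:R * e); first by case: Enx => _ /=; rewrite in_itv/= => /andP[].
  case: (VP n) => oV EV _.
  have : nbhs x (V n) by apply: open_nbhs_nbhs; split => //; exact: EV.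
  apply: filterS => y Oy.
  apply: (@le_trans _ _ (\sum_(0 <= k < n.+1) ((k.+1%:R * e)%:E * (\1_(V k) y)%:E))%E).
    rewrite big_nat_recr//= indicE mem_set// mule1.
    by rewrite leeDr// sume_ge0.
  exact: nneseries_lim_ge.
Qed.
Lemma derivable_near_le (g : R -> R) s c : derivable g s 1 -> `|'D_1 g s| < c ->
  \forall y \near s, `|g y - g s| <= c * `|y - s|.
Proof.
move=> dg gc; have /(nbhs_ballP (0 : R))[d d0 H] : nbhs (0 : R) [set h : R | h != 0 ->
    `|h^-1 *: (g (h *: 1 + s) - g s)| < c].
  exact: (cvgr_norm_lt _ dg _ gc).
apply/nbhs_ballP; exists d => //= y; rewrite /ball/= distrC => ysd.
have [->|ys] := eqVneq y s; first by rewrite !subrr normr0 mulr0.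
have := H (y - s); rewrite /ball/= sub0r normrN subr_eq0 => /(_ ysd ys)/ltW.
rewrite /= -[((y - s)^-1 *: _)]/((y - s)^-1 * _).
rewrite -[(y - s) *: 1]/((y - s) * 1) mulr1 subrK.
by rewrite normrM normfV ler_pdivrMl ?normr_gt0 ?subr_eq0// mulrC.
Qed.

(** As [phi] is only measurable, the fundamental theorem is replaced by a
    creeping argument along the primitive of a majorant as above. *)
Lemma ftc_le (g phi : R -> R) (a b : R) : a <= b ->
  measurable_fun `[a, b] phi ->
  (forall x, a <= x <= b -> derivable g x 1 /\ `|'D_1 g x| <= phi x) ->
  (`|g b - g a|%:E <= \int[mu]_(x in `[a, b]) (phi x)%:E)%E.
Proof.
move=> ab mphi dg; apply/lee_addgt0Pr => eps eps0.
have phi0 x : a <= x <= b -> 0 <= phi x.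
  by move=> /dg[_]; apply: le_trans.
have [Phi [mPhi Phi0 + PhiP]] := lower_majorant ab eps0 mphi phi0.
apply: le_trans.
pose psi y := (\int[mu]_(x in `[a, y]) Phi x)%E.
have psi_le x y : x <= y -> (psi x <= psi y)%E.
  move=> xy; apply: ge0_subset_integral => //; first exact: measurable_funTS.
  by apply: subset_itvl; rewrite bnd_simp.
(* Points up to which the estimate holds; the creeping argument shows that [sup S] belongs to [S]
   and equals [b]. *)
pose S := [set x | a <= x <= b /\ (`|g x - g a|%:E <= psi x)%E].
have Sa : S a.
  by split; [rewrite lexx ab|rewrite subrr normr0 integral_ge0].
have hS : has_sup S.
  by split; [exists a|exists b => x [/andP[]]].
pose s := sup S.
have as_ : a <= s by apply: ub_le_sup => //; case: hS.
have sb : s <= b by apply: ge_sup; [exists a|move=> x [/andP[]]].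
have sab : a <= s <= b by rewrite as_ sb.
have [dgs gs] := dg _ sab.
(* Points of [S] accumulate at [s] from below; [g] is continuous at [s] and [psi] is monotone. *)
have Ss : S s.
  split => //; apply/lee_addgt0Pr => e e0.
  have cg : {for s, continuous g} by apply: differentiable_continuous; exact/derivable1_diffP.
  have /(nbhs_ballP s)[d d0 H] : nbhs s [set x | `|g s - g x| < e].
    by move/cvgrPdist_lt : cg; exact.
  have [x Sx sx] := sup_adherent d0 hS.
  have xs : x <= s by apply: ub_le_sup => //; case: hS.
  have gsx : `|g s - g x| < e.
    apply: H; rewrite /ball/= ger0_norm ?subr_ge0//.
    by rewrite ltrBlDr -ltrBlDl.
  apply: (@le_trans _ _ (`|g x - g a|%:E + `|g s - g x|%:E)%E).
    by rewrite -EFinD lee_fin [leRHS]addrC (le_trans _ (ler_normD _ _))// subrKA.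
  apply: leeD; last by rewrite lee_fin ltW.
  by case: Sx => _ /le_trans; apply; exact: psi_le.
suff -> : b = s by case: Ss.
(* If [s < b], then just after [s] the function [g] moves by at most [c * (y - s)] while [psi] gains
   at least as much, because [Phi >= c] near [s]; so [S] would contain some [y > s]. *)
apply/eqP; rewrite eq_le sb andbT leNgt; apply/negP => slb.
have [c phic Phic] := PhiP _ sab.
have := derivable_near_le dgs (le_lt_trans gs phic).
move=> /(filterI Phic)/(nbhs_ballP s)[d d0 H].
pose y := s + Num.min (d / 2) (b - s).
have m0 : 0 < Num.min (d / 2) (b - s) by rewrite lt_min divr_gt0// subr_gt0.
have sy : s < y by rewrite ltrDl.
have yb : y <= b by rewrite -lerBrDl ge_min lexx orbT.
have yd : y - s < d.
  by rewrite /y addrAC subrr add0r gt_min ltr_pdivrMr// ltr_pMr// ltr1n.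
suff Sy : S y by have := ub_le_sup (proj2 hS) Sy; rewrite leNgt sy.
split; first by rewrite yb (le_trans as_ (ltW sy)).
have -> : psi y = (psi s + \int[mu]_(x in `]s, y]) Phi x)%E.
  rewrite /psi (@itv_bndbnd_setU _ _ _ (BRight s)) ?bnd_simp//; last exact: ltW.
  rewrite ge0_integral_setU//; first exact: measurable_funTS.
  apply/disj_setPS => z [/=]; rewrite !in_itv/= => /andP[_ zs] /andP[].
  by rewrite ltNge zs.
apply: (@le_trans _ _ (`|g s - g a|%:E + (c * (y - s))%:E)%E).
  have /(_ _)[|_] := H y; first by rewrite /ball/= distrC gtr0_norm ?subr_gt0.
  rewrite [`|y - s|]gtr0_norm ?subr_gt0// => gy.
  rewrite -EFinD lee_fin (le_trans _ (lerD (lexx _) gy))//.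
  by rewrite [leRHS]addrC (le_trans _ (ler_normD _ _))// subrKA.
apply: leeD; first by case: Ss.
have -> : (c * (y - s))%:E = (\int[mu]_(x in `]s, y]) c%:E)%E.
  have musy : mu `]s, y] = (y - s)%:E by rewrite lebesgue_measure_itv/= lte_fin sy.
  by rewrite EFinM -[(y - s)%:E]musy; apply/esym/integral_cst.
apply: ge0_le_integral => //.
- move=> x _; rewrite lee_fin (le_trans _ (ltW phic))//; exact: phi0.
- exact: measurable_funTS.
- move=> x /=; rewrite in_itv/= => /andP[sx xy].
  have /(_ _)[|] := H x => //; rewrite /ball/= distrC gtr0_norm ?subr_gt0//.
  by rewrite (le_lt_trans _ yd)// lerD2r.
Qed.
End ftc_inequality.

(** * Polar coordinates *)

Section expanding_substitution.
Context {R : realType}.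
Notation mu := (@lebesgue_measure R).

(** [Y] fits in the interval of length [d] that starts at its infimum. *)
Lemma lebesgue_diam (Y : set R) (d : R) : measurable Y -> 0 <= d ->
  (forall x y, Y x -> Y y -> `|x - y| <= d) -> (mu Y <= d%:E)%E.
Proof.
move=> mY d0 Yd; have [->|/set0P[y Yy]] := eqVneq Y set0.
  by rewrite measure0 lee_fin.
have hY : has_inf Y.
  split; first by exists y.
  by exists (y - d) => z Yz; rewrite lerBlDr -lerBlDl (le_trans (ler_norm _))// Yd.
have : Y `<=` `[inf Y, inf Y + d].
  move=> z Yz /=; rewrite in_itv/=; apply/andP; split.
    by apply: ge_inf => //; case: hY.
  rewrite -lerBlDr; apply: lb_le_inf; first by exists z.
  by move=> w Yw; rewrite lerBlDr -lerBlDl (le_trans (ler_norm _))// Yd.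
move=> /(le_lebesgue mY) => /(_ (measurable_itv _)) /le_trans; apply.
rewrite lebesgue_measure_itv/= lte_fin; case: ifPn => _; last by rewrite lee_fin.
by rewrite -EFinD lee_fin addrAC subrr add0r.
Qed.

(** The measure of [A] is an infimum over covers by half-open intervals, and within [J] the preimage
    of an interval of length [l] has diameter at most [l / c]. *)
Lemma lebesgue_expanding (J A : set R) (h : R -> R) (c : R) : measurable J ->
  measurable_fun setT h -> 0 < c ->
  {in J &, forall x y, c * `|x - y| <= `|h x - h y|} ->
  measurable A -> (c%:E * mu (h @^-1` A `&` J) <= mu A)%E.
Proof.
move=> mJ mh c0 hc mA.
have mpre (B : set R) : measurable B -> measurable (h @^-1` B `&` J).
  by move=> mB; apply: measurableI => //; rewrite -[X in measurable X]setTI; exact: mh.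
have [|Afin] := leP +oo%E (mu A); first by rewrite leye_eq => /eqP ->; rewrite leey.
apply/lee_addgt0Pr => eps eps0.
(* Unfolds Lebesgue measure as an infimum and picks a cover [M] of [A] that is optimal up to [eps];
   finiteness of [mu A] makes the inequality strict. *)
have /ereal_inf_lt[z [/= M [mM AM] sMz] zDe] : (mu A < mu A + eps%:E)%E.
  by rewrite lte_spaddre// ge0_fin_numE.
apply: (le_trans _ (ltW zDe)); rewrite -sMz.
have mMr n : measurable (M n : set R).
  by have /ocitvP[->|[[p q] /= _ ->]] := mM n.
apply: (@le_trans _ _ (c%:E * \sum_(k <oo) mu (h @^-1` (M k) `&` J))%E).
  apply: lee_wpmul2l; first by rewrite lee_fin ltW.
  have sub : h @^-1` A `&` J `<=` \bigcup_k (h @^-1` (M k) `&` J).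
    by move=> x [/= /AM[k _ Mk] Jx]; exists k.
  apply: (@le_trans _ _ (mu (\bigcup_k (h @^-1` (M k) `&` J)))).
    apply: le_lebesgue => //; first exact: mpre.
    by apply: bigcup_measurable => k _; exact: mpre.
  apply: measure_sigma_subadditive => // [k|].
    exact: mpre.
  by apply: bigcup_measurable => k _; exact: mpre.
rewrite -nneseriesZl//.
apply: lee_nneseries => [n _ _|n _]; first by rewrite mule_ge0// lee_fin ltW.
have mp := mpre _ (mMr n); move: mp.
have /ocitvP[->|[[p q] /= pq ->]] := mM n.
  by rewrite preimage_set0 set0I !measure0 mule0.
move=> mp; rewrite wlength_itv/= lte_fin pq.
have : (mu (h @^-1` `]p, q] `&` J) <= ((q - p) / c)%:E)%E.
  apply: lebesgue_diam => //; first by rewrite divr_ge0 ?subr_ge0// ltW.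
  move=> x y [/=] + Jx [/=] + Jy; rewrite !in_itv/= => /andP[px xq] /andP[py yq].
  rewrite ler_pdivlMr// mulrC (le_trans (hc _ _ _ _)) ?inE//.
  by rewrite ler_norml; apply/andP; split; lra.
move=> /(lee_wpmul2l (_ : (0 <= c%:E)%E)) /le_trans; apply; first by rewrite lee_fin ltW.
by rewrite -EFinM -EFinB lee_fin mulrC divfK// gt_eqF.
Qed.

(** By [lebesgue_expanding], [c] times the image under [h] of the measure restricted to [J] is below
    Lebesgue measure, and the integral of a nonnegative function is monotone in the measure. This is
    the only change of variables used. *)
Lemma integral_expanding (J B : set R) (h : R -> R) (c : R) (G : R -> \bar R) :
  measurable J -> measurable B -> measurable_fun setT h -> 0 < c ->
  {in J &, forall x y, c * `|x - y| <= `|h x - h y|} -> J `<=` h @^-1` B ->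
  measurable_fun setT G -> (forall x, 0 <= G x)%E ->
  (c%:E * \int[mu]_(x in J) G (h x) <= \int[mu]_(x in B) G x)%E.
Proof.
move=> mJ mB mh c0 hc JB mG G0.
have mhB : measurable (h @^-1` B) by rewrite -[X in measurable X]setTI; exact: mh.
pose nu := mrestr mu mJ.
pose h' : measurableTypeR R -> measurableTypeR R := h.
have mh' : measurable_fun setT h' := mh.
have mG' : @measurable_fun _ _ (measurableTypeR R) (\bar R) setT G := mG.
have mGh : measurable_fun setT (G \o h) by exact: measurableT_comp.
have c0' : 0 <= c by exact: ltW.
apply: (@le_trans _ _ (\int[mscale (NngNum c0') (pushforward nu h')]_(x in B) G x)%E).
  rewrite ge0_integral_mscale//; last exact: measurable_funTS.
  apply: lee_wpmul2l; first by rewrite lee_fin.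
  rewrite ge0_integral_pushforward//; last exact: measurable_funTS.
  apply: (@le_trans _ _ (\int[nu]_(x in J) G (h x))%E).
    rewrite le_eqVlt; apply/orP; left; apply/eqP.
    apply: eq_measure_integral => S mS SJ; rewrite /nu/= /mrestr.
    by congr (mu _); apply/esym/setIidPl.
  apply: ge0_subset_integral => //; first exact: measurable_funTS.
apply: (@ge0_le_measure_integral _ _ _
  (mscale (NngNum c0') (pushforward nu h')) mu) => // S mS.
rewrite /mscale/= /pushforward/= /nu /mrestr.
exact: (lebesgue_expanding mJ mh c0 hc mS).
Qed.
End expanding_substitution.

Section polar.
Context {R : realType}.
Notation mu := (@lebesgue_measure R).
Notation T := (measurableTypeR R).
Implicit Types (G : T * T -> \bar R) (s r u v t : R).

Lemma integral_prod_xsection (E : set (T * T)) G : measurable E ->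
  measurable_fun setT G -> (forall z, 0 <= G z)%E ->
  (\int[mu \x mu]_(z in E) G z =
   \int[mu]_x \int[mu]_(y in xsection E x) G (x, y))%E.
Proof.
move=> mE mG G0; rewrite integral_mkcond fubini_tonelli1//; last 2 first.
- by apply/measurable_restrict => //; exact: measurable_funTS.
- by move=> z; apply: erestrict_ge0.
apply: eq_integral => x _; rewrite /fubini_F [RHS]integral_mkcond.
by apply: eq_integral => y _; rewrite !patchE mem_xsection.
Qed.

Lemma integral_prod_ysection (E : set (T * T)) G : measurable E ->
  measurable_fun setT G -> (forall z, 0 <= G z)%E ->
  (\int[mu \x mu]_(z in E) G z =
   \int[mu]_y \int[mu]_(x in ysection E y) G (x, y))%E.
Proof.
move=> mE mG G0; rewrite integral_mkcond fubini_tonelli2//; last 2 first.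
- by apply/measurable_restrict => //; exact: measurable_funTS.
- by move=> z; apply: erestrict_ge0.
apply: eq_integral => y _; rewrite /fubini_G [RHS]integral_mkcond.
by apply: eq_integral => x _; rewrite !patchE mem_ysection.
Qed.

Lemma measurable_integral_xsection (E : set (T * T)) G : measurable E ->
  measurable_fun setT G -> (forall z, 0 <= G z)%E ->
  measurable_fun setT (fun x : T => (\int[mu]_(y in xsection E x) G (x, y))%E).
Proof.
move=> mE mG G0.
have := @measurable_fun_fubini_tonelli_F _ _ _ _ _ mu (G \_ E).
have -> : fubini_F mu (G \_ E) =
    (fun x : T => (\int[mu]_(y in xsection E x) G (x, y))%E).
  apply/funext => x; rewrite /fubini_F [RHS]integral_mkcond.
  by apply: eq_integral => y _; rewrite !patchE mem_xsection.
apply; last by move=> z; exact: erestrict_ge0.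
by apply/measurable_restrict => //; exact: measurable_funTS.
Qed.

Lemma measurable_integral_ysection (E : set (T * T)) G : measurable E ->
  measurable_fun setT G -> (forall z, 0 <= G z)%E ->
  measurable_fun setT (fun y : T => (\int[mu]_(x in ysection E y) G (x, y))%E).
Proof.
move=> mE mG G0.
have := @measurable_fun_fubini_tonelli_G _ _ _ _ _ mu (G \_ E).
have -> : fubini_G mu (G \_ E) =
    (fun y : T => (\int[mu]_(x in ysection E y) G (x, y))%E).
  apply/funext => y; rewrite /fubini_G [RHS]integral_mkcond.
  by apply: eq_integral => x _; rewrite !patchE mem_ysection.
apply; last by move=> z; exact: erestrict_ge0.
by apply/measurable_restrict => //; exact: measurable_funTS.
Qed.

Lemma xsection_setTX (D : set T) (x : T) : xsection ([set: T] `*` D) x = D.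
Proof. by apply/seteqP; split => y; [move=> /xsectionP[]|move=> Dy; apply/xsectionP]. Qed.

Lemma measurable_integral_r (D : set T) G : measurable D ->
  measurable_fun setT G -> (forall z, 0 <= G z)%E ->
  measurable_fun setT (fun x : T => (\int[mu]_(y in D) G (x, y))%E).
Proof.
move=> mD mG G0.
have mTD : measurable ([set: T] `*` D) by exact: measurableX.
have := measurable_integral_xsection mTD mG G0.
by under eq_fun do rewrite xsection_setTX.
Qed.

Definition annulus s : set (T * T) :=
  [set z | s ^+ 2 < z.1 ^+ 2 + z.2 ^+ 2 < 1].

Lemma measurable_preimage_fun d (X : measurableType d) (f : X -> R) (A : set R) :
  measurable_fun setT f -> measurable A -> measurable (f @^-1` A).
Proof. by move=> mf mA; rewrite -[X in measurable X]setTI; exact: mf. Qed.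

Lemma measurable_sqrD :
  measurable_fun setT (fun z : T * T => (z.1 ^+ 2 + z.2 ^+ 2 : T)).
Proof.
by apply: measurable_funD; apply: measurable_funX;
  [exact: measurable_fst|exact: measurable_snd].
Qed.

Lemma measurable_annulus s : measurable (annulus s).
Proof.
have -> : annulus s = (fun z : T * T => z.1 ^+ 2 + z.2 ^+ 2) @^-1` `]s ^+ 2, 1[.
  by apply/seteqP; split => z /=; rewrite in_itv.
by apply: measurable_preimage_fun => //; exact: measurable_sqrD.
Qed.

Definition polar_map (p : T * T) : T * T := (p.1 * cos p.2, p.1 * sin p.2).

Lemma measurable_cos_T : measurable_fun setT (cos : T -> T).
Proof. exact: (continuous_measurable_fun (@continuous_cos R)). Qed.

Lemma measurable_sin_T : measurable_fun setT (sin : T -> T).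
Proof. exact: (continuous_measurable_fun (@continuous_sin R)). Qed.

Lemma measurable_sqrt_T : measurable_fun setT (Num.sqrt : T -> T).
Proof. exact: (continuous_measurable_fun (@sqrt_continuous R)). Qed.

Lemma measurable_polar_map : measurable_fun setT polar_map.
Proof.
apply: measurable_fun_pair; apply: measurable_funM; try exact: measurable_fst.
- exact: (measurableT_comp measurable_cos_T measurable_snd).
- exact: (measurableT_comp measurable_sin_T measurable_snd).
Qed.

(** Arc of opening [pi / 2] centred at [t + pi / 2]. For [t = 0] the sine is bounded below on it, so
    that the abscissa [r cos t] is a good parameter there. *)
Definition quarter (t : R) : set T := `[t + pi / 4, t + pi / 4 + pi / 2].

(** [2 t - pi] lies in [[- pi / 2, pi / 2]], so its cosine [sin^2 t - cos^2 t] is nonnegative and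
    [sin^2 t >= 1/2]. *)
Lemma sin_quarter t : quarter 0 t -> 2^-1 <= sin t.
Proof.
rewrite /quarter/= add0r in_itv/= => /andP[t1 t2].
have pi0 := pi_gt0 R.
have s0 : 0 <= sin t by apply: sin_ge0_pi; apply/andP; split; lra.
have : 0 <= cos (t + t - pi) by apply: cos_ge0_pihalf; apply/andP; split; lra.
have -> : cos (t + t - pi) = sin t ^+ 2 - cos t ^+ 2.
  by rewrite cosB cospi sinpi mulr0 addr0 mulrN1 cosD !expr2 opprB.
have := cos2Dsin2 t => cs h.
have h2 : 2^-1 ^+ 2 <= sin t ^+ 2 by nra.
by rewrite -(ler_pXn2r (n := 2)) ?nnegrE.
Qed.

Lemma cos_expanding t t' : quarter 0 t -> quarter 0 t' ->
  2^-1 * `|t - t'| <= `|cos t - cos t'|.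
Proof.
wlog tt' : t t' / t <= t'.
  move=> H Ht Ht'; have [|/ltW] := leP t t'; first by move=> ?; exact: H.
  by move=> ?; rewrite distrC (distrC (cos t)); exact: H.
move=> Ht Ht'.
have dcos x : x \in `]t, t'[ -> is_derive x 1 (@cos R) (- sin x).
  by move=> _; exact: is_derive_cos.
have ccos : {within `[t, t'], continuous (@cos R)}.
  by apply: continuous_subspaceT; exact: continuous_cos.
have [c + cc] := MVT_segment tt' dcos ccos.
rewrite in_itv/= => /andP[tc ct'].
rewrite distrC [leRHS]distrC cc normrM normrN ler_wpM2r//.
apply: le_trans (ler_norm _); apply: sin_quarter.
move: Ht Ht'; rewrite /quarter/= !in_itv/= => /andP[a1 a2] /andP[a3 a4].
by rewrite (le_trans a1 tc) (le_trans ct' a4).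
Qed.

(** With [x], [y] the two roots, [(y - x) (y + x) = (r' - r) (r' + r)], while [y + x <= r' + r]. *)
Lemma sqrt_expanding u r r' : `|u| <= r -> `|u| <= r' ->
  `|r - r'| <= `|Num.sqrt (r ^+ 2 - u ^+ 2) - Num.sqrt (r' ^+ 2 - u ^+ 2)|.
Proof.
have H x : `|u| <= x -> 0 <= Num.sqrt (x ^+ 2 - u ^+ 2) <= x /\
    Num.sqrt (x ^+ 2 - u ^+ 2) ^+ 2 = x ^+ 2 - u ^+ 2.
  move=> ux; have x0 : 0 <= x := le_trans (normr_ge0 _) ux.
  have e : 0 <= x ^+ 2 - u ^+ 2.
    by rewrite subr_ge0 -real_normK ?num_real// ler_pXn2r ?nnegrE.
  split; last exact: sqr_sqrtr.
  rewrite sqrtr_ge0/= -[leRHS](ger0_norm x0) -sqrtr_sqr ler_wsqrtr//.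
  by rewrite gerBl sqr_ge0.
wlog rr' : r r' / r <= r'.
  move=> HH Hr Hr'; have [|/ltW] := leP r r'; first by move=> ?; exact: HH.
  by move=> ?; rewrite distrC [leRHS]distrC; exact: HH.
move=> /H[/andP[a1 a2] a3] /H[/andP[b1 b2] b3].
set x := Num.sqrt _ in a1 a2 a3 *; set y := Num.sqrt _ in b1 b2 b3 *.
rewrite distrC ger0_norm ?subr_ge0// distrC.
apply: le_trans (ler_norm _).
have [->|rNr'] := eqVneq r r'; first by nra.
have rr'0 : r < r' by rewrite lt_neqAle rNr'.
have e : (y - x) * (y + x) = (r' - r) * (r' + r) by ring: a3 b3.
rewrite leNgt; apply/negP => xy.
have yx0 : 0 < y + x by rewrite ltNge; apply/negP => h; nra.
have : (y - x) * (y + x) < (r' - r) * (y + x) by rewrite ltr_pM2r.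
nra.
Qed.
End polar.

(** * Comparison of [dr dt] with area on one quarter of an annulus *)

Section polar_inequality.
Context {R : realType}.
Notation mu := (@lebesgue_measure R).
Notation T := (measurableTypeR R).
Implicit Types (G : T * T -> \bar R) (s r u v t : R).

(** Two substitutions through the mixed coordinates [(r, u)] with [u = r cos t]: from [t] to [u] at
    fixed [r], then, after Tonelli, from [r] to [v = sqrt (r^2 - u^2)] at fixed [u]. The first costs
    the factor 4, the second nothing. *)
Lemma quarter_polar0 s G : 2^-1 <= s ->
  measurable_fun setT G -> (forall z, 0 <= G z)%E ->
  (\int[mu]_(r in `]s, 1%R[) \int[mu]_(t in quarter 0) G (polar_map (r, t)) <=
   4%:E * \int[mu \x mu]_(z in annulus s) G z)%E.
Proof.
move=> s12 mG G0.
(* Domain of the mixed coordinates [(r, u)]; [f] below is [G] expressed in them, on the upper half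
   plane. *)
pose E : set (T * T) := [set p | s < p.1 < 1 /\ `|p.2| <= p.1].
pose f (p : T * T) := G (p.2, Num.sqrt (p.1 ^+ 2 - p.2 ^+ 2)).
have mE : measurable E.
  have -> : E = fst @^-1` `]s, 1[%classic `&`
      (fun p : T * T => p.1 - `|p.2|) @^-1` `[0, +oo[%classic.
    by apply/seteqP; split => p [/= p1 p2]; split => //; move: p1 p2;
      rewrite /= !in_itv/= ?andbT subr_ge0.
  apply: measurableI.
    by apply: (@measurable_preimage_fun _ _ (T * T)%type) => //; exact: measurable_fst.
  apply: (@measurable_preimage_fun _ _ (T * T)%type) => //.
  apply: measurable_funB; first exact: measurable_fst.
  by apply: measurableT_comp => //; exact: measurable_snd.
have mf : measurable_fun setT f.
  apply: (measurableT_comp mG); apply: measurable_fun_pair; first exact: measurable_snd.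
  have m2 : measurable_fun setT (fun p : T * T => (p.1 ^+ 2 - p.2 ^+ 2 : T)).
    by apply: measurable_funB; apply: measurable_funX;
      [exact: measurable_fst|exact: measurable_snd].
  exact: (measurableT_comp measurable_sqrt_T m2).
have f0 z : (0 <= f z)%E by exact: G0.
have mGp : measurable_fun setT (G \o polar_map).
  by apply: measurableT_comp => //; exact: measurable_polar_map.
have mq : measurable (quarter 0 : set T) by exact: measurable_itv.
have ms : measurable (`]s, 1[%classic : set T) by exact: measurable_itv.
have mxs r : measurable (xsection E r) by exact: measurable_xsection.
have H1 : measurable_fun setT
    (fun x : T => (\int[mu]_(y in quarter 0) G (polar_map (x, y)))%E).
  by have := measurable_integral_r mq mGp; apply => z; exact: G0.
have H2 : measurable_fun setT (fun x : T => (\int[mu]_(y in xsection E x) f (x, y))%E).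
  exact: measurable_integral_xsection.
apply: (@le_trans _ _ (\int[mu]_(r in `]s, 1%R[)
    (4%:E * \int[mu]_(u in xsection E r) f (r, u)))%E).
  apply: ge0_le_integral => //.
  - by move=> r _; apply: integral_ge0 => t _; exact: G0.
  - exact: measurable_funTS.
  - by apply: measurable_funTS; exact: measurable_funeM.
  move=> r /=; rewrite in_itv/= => /andP[sr r1].
  have r0 : 0 < r by lra.
  rewrite -lee_pdivrMl//.
  pose g u := f (r, u).
  have mg : measurable_fun setT g by exact: (measurable_fun_pair2 _ mf).
  pose h (t : R) : R := r * cos t.
  have mh : measurable_fun setT h by apply: measurable_funM => //; exact: measurable_cos_T.
  (* [1/4] is the product of [r >= 1/2] and the expansion [1/2] of the cosine. *)
  have hq : {in quarter 0 &, forall x y, 4^-1 * `|x - y| <= `|h x - h y|}.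
    move=> x y; rewrite !inE => qx qy; rewrite /h -mulrBr normrM gtr0_norm//.
    have := cos_expanding qx qy; set a := `|x - y|; set b := `|cos x - cos y|.
    by have : 0 <= a := normr_ge0 _; nra.
  have hB : quarter 0 `<=` h @^-1` (xsection E r).
    move=> t _; apply/xsectionP; split => /=; first by rewrite sr r1.
    by rewrite /h normrM (gtr0_norm r0) ger_pMr// ler_norml cos_geN1 cos_le1.
  have q4 : 0 < 4^-1 :> R by rewrite invr_gt0.
  apply: le_trans (integral_expanding mq (mxs r) mh q4 hq hB mg (fun x => f0 (r, x))).
  apply: lee_wpmul2l; first by rewrite lee_fin invr_ge0.
  rewrite le_eqVlt; apply/orP; left; apply/eqP.
  apply: eq_integral => t /[!inE] qt; rewrite /g /f /polar_map /h/=.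
  congr (G (_, _)).
  have -> : r ^+ 2 - (r * cos t) ^+ 2 = (r * sin t) ^+ 2.
    by rewrite !exprMn -[X in X - _]mulr1 -mulrBr; congr (_ * _); have := cos2Dsin2 t; lra.
  rewrite sqrtr_sqr ger0_norm// mulr_ge0 ?(ltW r0)//.
  by have := sin_quarter qt; lra.
rewrite ge0_integralZl//; last 2 first.
- exact: measurable_funTS.
- by move=> r _; apply: integral_ge0.
apply: lee_wpmul2l; first by rewrite lee_fin.
apply: (@le_trans _ _ (\int[mu]_r \int[mu]_(u in xsection E r) f (r, u))%E).
  apply: ge0_subset_integral => //; first by move=> r _; exact: integral_ge0.
rewrite -integral_prod_xsection// integral_prod_ysection//.
rewrite integral_prod_xsection//; last exact: measurable_annulus.
apply: ge0_le_integral => //.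
- by move=> u _; apply: integral_ge0.
- exact: measurable_integral_ysection.
- exact: (measurable_integral_xsection (measurable_annulus s)).
move=> u _.
have := @integral_expanding R (ysection E u) (xsection (annulus s) u)
  (fun r => Num.sqrt (r ^+ 2 - u ^+ 2)) 1 (fun v => G (u, v)).
rewrite mul1e; apply => //.
- exact: measurable_ysection.
- exact: (measurable_xsection _ (measurable_annulus s)).
- have m2 : measurable_fun setT (fun r : T => (r ^+ 2 - u ^+ 2 : T)).
    by apply: measurable_funB => //; exact: exprn_measurable.
  exact: (measurableT_comp measurable_sqrt_T m2).
- move=> r r' /[!inE] /ysectionP[/= _ ru] /ysectionP[/= _ ru'].
  by rewrite mul1r; exact: sqrt_expanding.
- move=> r /ysectionP[/= /andP[sr r1] ru].
  apply/xsectionP; rewrite /annulus/= sqr_sqrtr; last first.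
    by rewrite subr_ge0 -(real_normK (num_real u)) ler_pXn2r ?nnegrE//; lra.
  by rewrite addrC subrK; apply/andP; split; nra.
- exact: (measurable_fun_pair2 _ mG).
Qed.
End polar_inequality.

(** * Rotations by right angles, and arcs of length at most [2 pi] *)

Section polar_inequality_general.
Context {R : realType}.
Notation mu := (@lebesgue_measure R).
Notation T := (measurableTypeR R).
Implicit Types (G : T * T -> \bar R) (s r u v t : R).

Lemma measurable_rotation (c : R) :
  measurable_fun setT (fun z : T * T => ((- c * z.2, c * z.1) : T * T)).
Proof.
by apply: measurable_fun_pair; apply: measurable_funM.
Qed.

(** The map is the rotation by [c] right angles, [c] being [1] or [-1]: Tonelli exchanges the
    coordinates, and each of them then undergoes an isometry of the line. *)
Lemma annulus_rotation s (c : R) G : c ^+ 2 = 1 ->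
  measurable_fun setT G -> (forall z, 0 <= G z)%E ->
  (\int[mu \x mu]_(z in annulus s) G (- c * z.2, c * z.1)%R <=
   \int[mu \x mu]_(z in annulus s) G z)%E.
Proof.
move=> c2 mG G0.
have c1 : `|c| = 1 by apply/eqP; rewrite -sqrp_eq1// real_normK ?num_real// c2.
have ma := @measurable_annulus R s.
have mG' := measurableT_comp mG (measurable_rotation c).
rewrite integral_prod_ysection//= integral_prod_xsection//.
pose H (x : T) := (\int[mu]_(y in xsection (annulus s) x) G (x, y))%E.
have mH : measurable_fun setT H by exact: measurable_integral_xsection.
have H0 x : (0 <= H x)%E by exact: integral_ge0.
have mc (d : R) : measurable_fun setT (fun x : R => d * x) by exact: measurable_funM.
apply: (@le_trans _ _ (\int[mu]_v H (- c * v)%R)%E).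
  apply: ge0_le_integral => //.
  - by move=> v _; exact: integral_ge0.
  - by have := measurable_integral_ysection ma mG'; apply => z; exact: G0.
  - exact: (measurableT_comp mH (mc (- c))).
  move=> v _.
  have e1 : {in ysection (annulus s) v &, forall x y, 1 * `|x - y| <= `|c * x - c * y|}.
    by move=> x y _ _; rewrite -mulrBr normrM c1.
  have e2 : ysection (annulus s) v `<=`
      (fun x : R => c * x) @^-1` xsection (annulus s) (- c * v).
    move=> u /ysectionP uv; apply/xsectionP.
    by move: uv; rewrite /annulus/= !exprMn sqrrN c2 !mul1r addrC.
  have := @integral_expanding R (ysection (annulus s) v) (xsection (annulus s) (- c * v))
    (fun x => c * x) 1 (fun y => G (- c * v, y)) (measurable_ysection _ ma)
    (measurable_xsection _ ma) (mc c) ltr01 e1 e2 (measurable_fun_pair2 _ mG)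
    (fun y => G0 _).
  by rewrite mul1e.
have e1 : {in [set: R] &, forall x y, 1 * `|x - y| <= `|- c * x - - c * y|}.
  by move=> x y _ _; rewrite -mulrBr normrM normrN c1.
have := @integral_expanding R setT setT (fun x => - c * x) 1 H measurableT measurableT
    (mc (- c)) ltr01 e1 (fun _ _ => I) mH H0.
by rewrite mul1e.
Qed.

(** Quantified over [G] so that the passage to the next quarter can apply it to a rotated
    integrand. *)
Definition quarter_bound (t0 : R) := forall s G, 2^-1 <= s ->
  measurable_fun setT G -> (forall z, 0 <= G z)%E ->
  (\int[mu]_(r in `]s, 1%R[) \int[mu]_(t in quarter t0) G (polar_map (r, t)) <=
   4%:E * \int[mu \x mu]_(z in annulus s) G z)%E.

Lemma measurable_polar_t (D : set T) G : measurable D ->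
  measurable_fun setT G -> (forall z, 0 <= G z)%E ->
  measurable_fun setT (fun r : T => (\int[mu]_(t in D) G (polar_map (r, t)))%E).
Proof.
move=> mD mG G0.
have mGp : measurable_fun setT (G \o polar_map).
  by apply: measurableT_comp => //; exact: measurable_polar_map.
by have := measurable_integral_r mD mGp; apply => z; exact: G0.
Qed.

Lemma measurable_polar_section G r : measurable_fun setT G ->
  measurable_fun setT (fun t : T => G (polar_map (r, t))).
Proof.
move=> mG; have mGp : measurable_fun setT (G \o polar_map).
  by apply: measurableT_comp => //; exact: measurable_polar_map.
exact: (measurable_fun_pair2 _ mGp).
Qed.

Lemma quarter_bound_rot (t0 c : R) : c = 1 \/ c = - 1 ->
  quarter_bound t0 -> quarter_bound (t0 + c * (pi / 2)).
Proof.
move=> c1 H s G s12 mG G0.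
have c2 : c ^+ 2 = 1 by case: c1 => ->; rewrite ?sqrrN expr1n.
have mG' := measurableT_comp mG (measurable_rotation c).
have mq t : measurable (quarter t : set T) by exact: measurable_itv.
apply: (le_trans _ (lee_wpmul2l _ (annulus_rotation s c2 mG G0))); last first.
  by rewrite lee_fin.
apply: (le_trans _ (H s _ s12 mG' _)); last by move=> z; exact: G0.
apply: ge0_le_integral => //.
- by move=> r _; exact: integral_ge0.
- by apply: measurable_funTS; exact: measurable_polar_t.
- apply: measurable_funTS; apply: (measurable_polar_t (mq _) mG') => z; exact: G0.
move=> r _.
pose h (t : R) := t - c * (pi / 2).
have mh : measurable_fun setT h by exact: measurable_funB.
have e1 : {in quarter (t0 + c * (pi / 2)) &, forall x y, 1 * `|x - y| <= `|h x - h y|}.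
  move=> x y _ _; rewrite /h mul1r.
  by have -> : x - c * (pi / 2) - (y - c * (pi / 2)) = x - y by ring.
have e2 : quarter (t0 + c * (pi / 2)) `<=` h @^-1` quarter t0.
  move=> x; rewrite /quarter/= !in_itv/= /h => /andP[x1 x2].
  by apply/andP; split; lra.
have := integral_expanding (mq (t0 + c * (pi / 2))) (mq t0) mh ltr01 e1 e2
  (measurable_polar_section r mG') (fun t => G0 _).
rewrite mul1e; apply: le_trans.
rewrite le_eqVlt; apply/orP; left; apply/eqP.
apply: eq_integral => t _; rewrite /= /h /polar_map/=.
case: c1 => ->; congr (G (_, _)).
- by rewrite mul1r sinBpihalf mulN1r mulrN opprK.
- by rewrite !mul1r cosBpihalf.
- by rewrite mulN1r !opprK sinDpihalf mul1r.
- by rewrite !mulN1r opprK cosDpihalf mulrN opprK.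
Qed.

Lemma quarter_boundP (k : int) : quarter_bound (k%:~R * (pi / 2)).
Proof.
elim/int_rect: k => [|n IH|n IH].
- rewrite mul0r => s G s12 mG G0; exact: quarter_polar0.
- rewrite intS addrC intrD mulrDl; exact: (quarter_bound_rot (or_introl erefl) IH).
- rewrite intS opprD addrC intrD mulrDl; exact: (quarter_bound_rot (or_intror erefl) IH).
Qed.

Lemma le_integral_setU (A B : set T) (f : T -> \bar R) : measurable A -> measurable B ->
  measurable_fun setT f -> (forall x, 0 <= f x)%E ->
  (\int[mu]_(x in A `|` B) f x <= \int[mu]_(x in A) f x + \int[mu]_(x in B) f x)%E.
Proof.
move=> mA mB mf f0.
have mBA : measurable (B `\` A) by exact: measurableD.
have -> : A `|` B = A `|` (B `\` A).
  apply/seteqP; split => x; last by case=> [|[]]; [left|right].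
  by have [Ax|nAx] := pselect (A x); [left|case=> // Bx; right].
rewrite ge0_integral_setU//; last 2 first.
- exact: measurable_funTS.
- by apply/disj_setPS => x [Ax []].
apply: leeD2l; apply: ge0_subset_integral => //.
exact: measurable_funTS.
Qed.

(** [al] is the left end of the quarter of index [k]; [n] adjacent quarters follow it, each at the
    price 4. *)
Lemma quarters_bound (k : int) (n : nat) s al G :
  al = k%:~R * (pi / 2) + pi / 4 -> 2^-1 <= s ->
  measurable_fun setT G -> (forall z, 0 <= G z)%E ->
  (\int[mu]_(r in `]s, 1%R[)
      \int[mu]_(t in `[al, (al + n%:R * (pi / 2))%R]) G (polar_map (r, t)) <=
   (n * 4)%:R%:E * \int[mu \x mu]_(z in annulus s) G z)%E.
Proof.
move=> alE s12 mG G0; elim: n => [|n IH].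
  rewrite mul0r addr0 mul0e integral0_eq// => r _.
  by rewrite set_itv1 integral_set1.
have pi0 := pi_gt0 R.
have qE : quarter ((k + n)%:~R * (pi / 2)) =
    `[al + n%:R * (pi / 2), al + n.+1%:R * (pi / 2)]%classic.
  rewrite /quarter alE intrD -pmulrn -(natr1 n); congr [set` Interval (BLeft _) (BRight _)];
    apply/funext => _; ring.
have sub : `[al, al + n.+1%:R * (pi / 2)]%classic `<=`
   `[al, al + n%:R * (pi / 2)]%classic `|` quarter ((k + n)%:~R * (pi / 2)).
  rewrite qE => t /=; rewrite !in_itv/= => /andP[t1 t2].
  by have [t3|/ltW t3] := leP t (al + n%:R * (pi / 2)); [left; rewrite t1|right; rewrite t3].
have mI (a b : R) : measurable (`[a, b]%classic : set T) by exact: measurable_itv.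
have mq t : measurable (quarter t : set T) by exact: measurable_itv.
rewrite mulSn natrD EFinD ge0_muleDl ?lee_fin// addeC.
apply: (le_trans _ (leeD IH (quarter_boundP (k + n) s12 mG G0))).
rewrite -ge0_integralD//; last 4 first.
- by move=> r _; exact: integral_ge0.
- by apply: measurable_funTS; exact: measurable_polar_t.
- by move=> r _; exact: integral_ge0.
- by apply: measurable_funTS; exact: measurable_polar_t.
apply: ge0_le_integral => //.
- by move=> r _; exact: integral_ge0.
- by apply: measurable_funTS; exact: measurable_polar_t.
- by apply: measurable_funTS; apply: emeasurable_funD; exact: measurable_polar_t.
move=> r _.
apply: (le_trans _ (le_integral_setU (mI _ _) (mq _) (measurable_polar_section r mG) _)) => //.
apply: ge0_subset_integral => //.
- exact: measurableU.
- by apply: measurable_funTS; exact: measurable_polar_section.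
Qed.

Lemma polar_le s (a b : R) G : 2^-1 <= s -> b - a <= 2 * pi ->
  measurable_fun setT G -> (forall z, 0 <= G z)%E ->
  (\int[mu]_(r in `]s, 1%R[) \int[mu]_(t in `[a, b]) G (polar_map (r, t)) <=
   20%:E * \int[mu \x mu]_(z in annulus s) G z)%E.
Proof.
move=> s12 ba mG G0; have pi0 := pi_gt0 R.
(* Index of the quarter that contains [a]. Five quarters from its left end reach at least [2 pi]
   beyond [a], whence [20 = 5 * 4]. *)
pose k := Num.floor ((a - pi / 4) / (pi / 2)).
have pi2 : 0 < pi / 2 :> R by rewrite divr_gt0.
have /andP[k1 k2] : k%:~R <= (a - pi / 4) / (pi / 2) < (k + 1)%:~R by exact: floor_itv.
rewrite ler_pdivlMr// in k1; have kE : (k + 1)%:~R = k%:~R + 1 :> R by rewrite intrD.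
rewrite ltr_pdivrMr// kE (mulrDl k%:~R) mul1r in k2.
apply: (le_trans _ (@quarters_bound k 5 s _ G erefl s12 mG G0)).
apply: ge0_le_integral => //.
- by move=> r _; exact: integral_ge0.
- by apply: measurable_funTS; exact: measurable_polar_t.
- by apply: measurable_funTS; exact: measurable_polar_t.
move=> r _; apply: ge0_subset_integral => //.
- by apply: measurable_funTS; exact: measurable_polar_section.
move=> t /=; rewrite !in_itv/= => /andP[t1 t2]; apply/andP; split; lra.
Qed.
End polar_inequality_general.

(** * Estimates along radii and circles *)

Section square_estimates.
Context {R : realType}.
Notation mu := (@lebesgue_measure R).
Notation T := (measurableTypeR R).

(** Cauchy-Schwarz recovered from the family of weighted arithmetic-geometric inequalities, by the
    optimal weight [l = x / L]. *)
Lemma sqr_le_amgm (x L Q : R) : 0 <= x -> 0 <= L -> 0 <= Q ->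
  (forall l, 0 < l -> x <= l * L / 2 + Q / (2 * l)) -> x ^+ 2 <= L * Q.
Proof.
move=> x0 L0 Q0 H; have [->|xN0] := eqVneq x 0; first by rewrite expr0n mulr_ge0.
have xp : 0 < x by rewrite lt_def xN0.
have [LE|LN0] := eqVneq L 0.
  (* For [L = 0] a large weight suffices: this one yields [x <= x / 2], against [0 < x]. *)
  have := H ((Q + 1) / x); rewrite divr_gt0 ?ltr_wpDl// => /(_ isT).
  rewrite LE mulr0 mul0r add0r.
  have -> : Q / (2 * ((Q + 1) / x)) = x * (Q / (2 * (Q + 1))).
    by field; rewrite xN0 gt_eqF// ltr_wpDl.
  have : Q / (2 * (Q + 1)) <= 1 / 2.
    by rewrite ler_pdivrMr ?mulr_gt0 ?ltr_wpDl//; lra.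
  nra.
have Lp : 0 < L by rewrite lt_def LN0.
have := H (x / L); rewrite divr_gt0// => /(_ isT).
have -> : x / L * L / 2 = x / 2 by field.
have -> : Q / (2 * (x / L)) = L * Q / (2 * x) by field; rewrite xN0 LN0.
move=> h; have : x / 2 <= L * Q / (2 * x) by lra.
by rewrite ler_pdivlMr ?mulr_gt0//; lra.
Qed.

Lemma lebesgue_itvcc (a b : R) : a <= b -> mu `[a, b] = (b - a)%:E.
Proof.
move=> ab; rewrite lebesgue_measure_itv/= lte_fin; case: ltP => // ba.
by rewrite (@le_anti _ _ a b) ?subrr// ab ba.
Qed.

(** [ftc_le] bounds the increment by the integral of [phi], and [phi <= l / 2 + phi^2 / (2 l)] for
    every [l > 0]; [sqr_le_amgm] then optimises [l]. *)
Lemma derive_sqr_le (g phi : R -> R) (a b Q : R) : a <= b ->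
  measurable_fun setT phi -> (forall x, 0 <= phi x) ->
  (forall x, a <= x <= b -> derivable g x 1 /\ `|'D_1 g x| <= phi x) ->
  (\int[mu]_(x in `[a, b]) (phi x ^+ 2)%:E <= Q%:E)%E ->
  (g b - g a) ^+ 2 <= (b - a) * Q.
Proof.
move=> ab mphi phi0 dg hQ.
have Q0 : 0 <= Q.
  by rewrite -lee_fin (le_trans _ hQ)// integral_ge0// => x _; rewrite lee_fin sqr_ge0.
rewrite -real_normK ?num_real//; apply: sqr_le_amgm => //; first by rewrite subr_ge0.
move=> l l0; rewrite -lee_fin.
have mI (c d : R) : measurable (`[c, d]%classic : set T) by exact: measurable_itv.
have mphi2 : measurable_fun setT (fun x : T => (phi x ^+ 2)%:E).
  by apply/measurable_EFinP; exact: measurable_funX.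
apply: (le_trans (ftc_le ab (measurable_funTS mphi) dg)).
apply: (@le_trans _ _ (\int[mu]_(x in `[a, b])
    ((l / 2)%:E + (2 * l)^-1%:E * (phi x ^+ 2)%:E))%E).
  apply: ge0_le_integral => //.
  - by move=> x _; rewrite lee_fin.
  - by apply/measurable_EFinP; exact: measurable_funTS.
  - by apply: measurable_funTS; apply: emeasurable_funD => //; exact: measurable_funeM.
  move=> x _; rewrite -EFinM -EFinD lee_fin.
  have -> : l / 2 + (2 * l)^-1 * phi x ^+ 2 = phi x + (2 * l)^-1 * (phi x - l) ^+ 2.
    by field; rewrite gt_eqF.
  by rewrite lerDl mulr_ge0 ?sqr_ge0// invr_ge0 mulr_ge0// ltW.
rewrite ge0_integralD//; last 3 first.
- by move=> x _; rewrite lee_fin divr_ge0// ltW.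
- by move=> x _; rewrite -EFinM lee_fin mulr_ge0 ?sqr_ge0// invr_ge0 mulr_ge0// ltW.
- by apply: measurable_funTS; exact: measurable_funeM.
rewrite integral_cst// [X in (_ * X + _)%E](lebesgue_itvcc ab) ge0_integralZl//; last 3 first.
- exact: measurable_funTS.
- by move=> x _; rewrite lee_fin sqr_ge0.
- by rewrite lee_fin invr_ge0 mulr_ge0// ltW.
rewrite [leRHS]EFinD; apply: leeD; first by rewrite -EFinM lee_fin mulrAC.
apply: (@le_trans _ _ ((2 * l)^-1%:E * Q%:E)%E).
  by apply: lee_wpmul2l => //; rewrite lee_fin invr_ge0 mulr_ge0// ltW.
by rewrite -EFinM lee_fin mulrC.
Qed.

(** The mean minimises the quadratic deviation: passing from [c] to the mean lowers the integral by
    [l * e^2], where [e] is the mean of [b - c]. Oscillation may thus be tested against any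
    convenient constant. *)
Lemma sqr_deviation_le (D : set T) (b : R -> R) (c K l : R) : measurable D ->
  mu D = l%:E -> 0 < l -> measurable_fun setT b ->
  (\int[mu]_(x in D) ((b x - c) ^+ 2)%:E <= K%:E)%E ->
  (\int[mu]_(x in D)
     ((b x - l^-1 * \int[mu]_(y in D) b y) ^+ 2)%:E <= K%:E)%E.
Proof.
move=> mD muD l0 mb hK.
set m := l^-1 * _.
pose u x := b x - c.
have mu_ : measurable_fun setT u by exact: measurable_funB.
have iu2 : mu.-integrable D (fun x => (u x ^+ 2)%:E).
  apply/integrableP; split.
    by apply/measurable_EFinP/measurable_funTS; exact: measurable_funX.
  under eq_integral do rewrite /= ger0_norm ?sqr_ge0//.
  by rewrite (le_lt_trans hK)// ltry.
have ic (d : R) : mu.-integrable D (fun=> d%:E).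
  apply/integrableP; split => //.
  by rewrite /= integral_cst// [X in (_ * X)%E]muD -EFinM ltry.
(* [|u| <= 1 + u^2] on a set of finite measure. *)
have iu : mu.-integrable D (EFin \o u).
  apply: (le_integrable mD _ _ (integrableD mD (ic 1) iu2)).
    by apply/measurable_EFinP; exact: measurable_funTS.
  move=> x _ /=; rewrite lee_fin [leRHS]ger0_norm ?addr_ge0 ?sqr_ge0//.
  rewrite -(real_normK (num_real (u x))); set a := `|u x|.
  by have : 0 <= a := normr_ge0 _; have := sqr_ge0 (a - 1); rewrite sqrrB1 mulr2n; lra.
have fD : fine (mu D) = l by rewrite muD.
have bE : \int[mu]_(y in D) b y = \int[mu]_(y in D) u y + c * l.
  transitivity (\int[mu]_(y in D) (u y + c)).
    by apply: eq_Rintegral => x _; rewrite /u subrK.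
  rewrite RintegralD//; last exact: ic.
  by rewrite Rintegral_cst// [fine _]fD.
pose e := l^-1 * \int[mu]_(y in D) u y.
have mE : m = e + c.
  by rewrite /m bE mulrDr /e mulrCA mulVf ?gt_eqF// mulr1.
have UE : \int[mu]_(y in D) u y = l * e by rewrite /e mulVKf// gt_eqF.
have ieu : mu.-integrable D (fun x => (2 * e * u x)%:E).
  by under eq_fun do rewrite EFinM; exact: integrableZl.
have I1 : mu.-integrable D (fun x => (u x ^+ 2 - 2 * e * u x)%:E).
  by under eq_fun do rewrite EFinB; exact: integrableB.
have key : \int[mu]_(x in D) ((b x - m) ^+ 2) = \int[mu]_(x in D) (u x ^+ 2) - l * e ^+ 2.
  transitivity (\int[mu]_(x in D) (u x ^+ 2 - 2 * e * u x + e ^+ 2)).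
    by apply: eq_Rintegral => x _; rewrite mE /u; ring.
  rewrite RintegralD//; last exact: ic.
  rewrite RintegralB// RintegralZl// Rintegral_cst// [fine _]fD UE; ring.
have ibm : mu.-integrable D (fun x => ((b x - m) ^+ 2)%:E).
  have -> : (fun x => ((b x - m) ^+ 2)%:E) =
      (fun x => (u x ^+ 2 - 2 * e * u x)%:E + (e ^+ 2)%:E)%E.
    by apply/funext => x; rewrite -EFinD mE /u; congr EFin; ring.
  exact: integrableD.
apply: le_trans hK.
rewrite -[leLHS]fineK; last exact: integrable_fin_num.
rewrite -[leRHS]fineK; last exact: integrable_fin_num.
rewrite lee_fin -/(Rintegral mu D (fun x => (b x - m) ^+ 2)) key.
by rewrite gerBl mulr_ge0 ?sqr_ge0// ltW.
Qed.
End square_estimates.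

(** * A real function of polar coordinates with both derivatives dominated by [D] *)

Section radial_estimates.
Context {R : realType}.
Notation mu := (@lebesgue_measure R).
Notation T := (measurableTypeR R).
Variables (D : T * T -> R) (p : R -> R -> R).
Hypothesis mD : measurable_fun setT D.
Hypothesis D0 : forall z, 0 <= D z.
Hypothesis dr : forall r t, 0 < r < 1 ->
  derivable (p ^~ t) r 1 /\ `|'D_1 (p ^~ t) r| <= D (polar_map (r, t)).
Hypothesis dt : forall r t, 0 < r < 1 ->
  derivable (p r) t 1 /\ `|'D_1 (p r) t| <= D (polar_map (r, t)).

Definition sqrE (z : T * T) : \bar R := (D z ^+ 2)%:E.

(** The quantity [X_s(t)]. It is taken with respect to [dr], not [r dr]; the constant of [polar_le]
    absorbs the difference when [s >= 1/2]. *)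
Definition radial_energy (s t : R) : \bar R :=
  (\int[mu]_(r in `]s, 1%R[) sqrE (polar_map (r, t)))%E.

Lemma measurable_sqrE : measurable_fun setT sqrE.
Proof. by apply/measurable_EFinP; exact: measurable_funX. Qed.

Lemma sqrE_ge0 z : (0 <= sqrE z)%E.
Proof. by rewrite lee_fin sqr_ge0. Qed.

Lemma radial_energy_ge0 s t : (0 <= radial_energy s t)%E.
Proof. by apply: integral_ge0 => r _; exact: sqrE_ge0. Qed.

Lemma measurable_sqrE_polar : measurable_fun setT (sqrE \o polar_map).
Proof. exact: (measurableT_comp measurable_sqrE measurable_polar_map). Qed.

Lemma measurable_sqrE_polar_r t :
  measurable_fun setT (fun r : T => sqrE (polar_map (r, t))).
Proof. exact: (measurable_fun_pair1 _ measurable_sqrE_polar). Qed.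

Lemma measurable_radial_energy s : measurable_fun setT (radial_energy s : T -> \bar R).
Proof.
have mE : measurable (`]s, 1%R[%classic `*` [set: T]).
  by apply: measurableX => //; exact: measurable_itv.
have := measurable_integral_ysection mE measurable_sqrE_polar.
have e : (fun t : T => (\int[mu]_(x in ysection (`]s, 1%R[%classic `*` [set: T]) t)
    (sqrE \o polar_map) (x, t))%E) = radial_energy s.
  apply/funext => t; rewrite /radial_energy.
  have -> // : ysection (`]s, 1%R[%classic `*` [set: T]) t = `]s, 1%R[%classic.
  by apply/seteqP; split => y; [move=> /ysectionP[]|move=> Dy; apply/ysectionP].
by rewrite e; apply => z; exact: sqrE_ge0.
Qed.

Lemma radial_energy_swap s (a b : R) :
  (\int[mu]_(t in `[a, b]) radial_energy s t =
   \int[mu]_(r in `]s, 1%R[) \int[mu]_(t in `[a, b]) sqrE (polar_map (r, t)))%E.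
Proof.
have mE : measurable ((`]s, 1%R[%classic : set T) `*` (`[a, b]%classic : set T)).
  by apply: measurableX; exact: measurable_itv.
have h := integral_prod_ysection mE measurable_sqrE_polar (fun z => sqrE_ge0 _).
rewrite (integral_prod_xsection mE measurable_sqrE_polar (fun z => sqrE_ge0 _)) in h.
transitivity (\int[mu]_y \int[mu]_(x in ysection (`]s, 1%R[ `*` `[a, b]) y)
  (sqrE \o polar_map) (x, y))%E; last first.
  rewrite -h [RHS]integral_mkcond; apply: eq_integral => x _.
  rewrite patchE; case: ifPn => xs.
    congr integral; apply/seteqP; split => y; first by move=> /xsectionP[].
    by move=> yab; apply/xsectionP; split => //=; move: xs; rewrite inE.
  rewrite (_ : xsection _ _ = set0) ?integral_set0//.
  rewrite -subset0 => y /xsectionP[/= xs' _].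
  by move: xs; rewrite notin_setE; apply.
rewrite [LHS]integral_mkcond; apply: eq_integral => y _.
rewrite patchE; case: ifPn => ys.
  congr integral; apply/seteqP; split => x; last by move=> /ysectionP[].
  by move=> xs; apply/ysectionP; split => //=; move: ys; rewrite inE.
rewrite (_ : ysection _ _ = set0) ?integral_set0//.
rewrite -subset0 => x /ysectionP[/= _ ys'].
by move: ys; rewrite notin_setE; apply.
Qed.

Lemma radial_sqr_le s r r' t Q : 0 <= s -> s < r -> r <= r' -> r' < 1 ->
  (radial_energy s t <= Q%:E)%E -> (p r' t - p r t) ^+ 2 <= (r' - r) * Q.
Proof.
move=> s0 sr rr' r'1 hQ.
apply: (@derive_sqr_le R (p ^~ t) (fun r => D (polar_map (r, t)))) => //.
- have mDp := measurableT_comp mD (@measurable_polar_map R).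
  exact: (measurable_fun_pair1 _ mDp).
- by move=> x /andP[x1 x2]; apply: dr; apply/andP; split; lra.
apply: le_trans hQ; apply: ge0_subset_integral => //.
- by apply: measurable_funTS; exact: measurable_sqrE_polar_r.
- by move=> x _; exact: sqrE_ge0.
- by move=> x /=; rewrite !in_itv/= => /andP[x1 x2]; apply/andP; split; lra.
Qed.

(** Averaging: if each circle carried more than [w / (1 - s)], integration over radii in an interval
    of length [1 - s] would give at least [w], against the strict hypothesis. *)
Lemma exists_good_radius s (a b : R) (w : R) : 0 <= s < 1 ->
  (\int[mu]_(r in `]s, 1%R[) \int[mu]_(t in `[a, b]) sqrE (polar_map (r, t)) < w%:E)%E ->
  exists2 r, s < r < 1 &
    (\int[mu]_(t in `[a, b]) sqrE (polar_map (r, t)) <= (w / (1 - s))%:E)%E.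
Proof.
move=> /andP[s0 s1] hw; apply: contrapT => H.
have {}H r : s < r < 1 ->
    ((w / (1 - s))%:E <= \int[mu]_(t in `[a, b]) sqrE (polar_map (r, t)))%E.
  move=> sr; apply/ltW; rewrite ltNge; apply/negP => h; apply: H; by exists r.
have w0 : 0 <= w.
  rewrite -lee_fin ltW// (le_lt_trans _ hw)// integral_ge0// => r _.
  by apply: integral_ge0 => t _; exact: sqrE_ge0.
move: hw; apply/negP; rewrite -leNgt.
have mI : measurable (`]s, 1%R[%classic : set T) by exact: measurable_itv.
have muI : mu `]s, 1[ = (1 - s)%:E by rewrite lebesgue_measure_itv/= lte_fin s1.
apply: (@le_trans _ _ (\int[mu]_(r in `]s, 1%R[) (w / (1 - s))%:E)%E).
  by rewrite integral_cst// [X in (_ * X)%E]muI -EFinM divfK// subr_eq0 gt_eqF.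
apply: ge0_le_integral => //.
- by move=> r _; rewrite lee_fin divr_ge0// subr_ge0 ltW.
- apply: measurable_funTS; apply: (measurable_polar_t _ measurable_sqrE) => // z.
  exact: sqrE_ge0.
Qed.

Lemma angular_sqr_le (r a b t Q : R) : 0 < r < 1 -> a <= t <= b -> 0 <= Q ->
  (\int[mu]_(t in `[a, b]) sqrE (polar_map (r, t)) <= Q%:E)%E ->
  (p r t - p r a) ^+ 2 <= (b - a) * Q.
Proof.
move=> r01 /andP[a_t tb] Q0 hQ.
apply: (@le_trans _ _ ((t - a) * Q)); last by rewrite ler_wpM2r// lerD2r.
apply: (@derive_sqr_le R (p r) (fun t => D (polar_map (r, t)))) => //.
- have mDp := measurableT_comp mD (@measurable_polar_map R).
  exact: (measurable_fun_pair2 _ mDp).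
- by move=> x _; exact: dt.
apply: le_trans hQ; apply: ge0_subset_integral => //.
- apply: measurable_funTS; exact: (measurable_polar_section r measurable_sqrE).
- by move=> x _; exact: sqrE_ge0.
- by apply: subset_itvl; rewrite bnd_simp.
Qed.

End radial_estimates.

(** * Passage to the boundary, for an abstract trace [b] *)

Section boundary_estimates.
Context {R : realType}.
Notation mu := (@lebesgue_measure R).
Notation T := (measurableTypeR R).
Variables (D : T * T -> R) (p : R -> R -> R) (b : R -> R).
Hypothesis mD : measurable_fun setT D.
Hypothesis D0 : forall z, 0 <= D z.
Hypothesis dr : forall r t, 0 < r < 1 ->
  derivable (p ^~ t) r 1 /\ `|'D_1 (p ^~ t) r| <= D (polar_map (r, t)).
Hypothesis dt : forall r t, 0 < r < 1 ->
  derivable (p r) t 1 /\ `|'D_1 (p r) t| <= D (polar_map (r, t)).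
Hypothesis mb : measurable_fun setT b.
Hypothesis pb : forall t, (radial_energy D 2^-1 t < +oo)%E ->
  p r t @[r --> 1^'-] --> b t.
Hypothesis finE : (\int[mu \x mu]_(z in annulus 2^-1) sqrE D z < +oo)%E.

Lemma radial_energy_le s s' t : s <= s' ->
  (radial_energy D s' t <= radial_energy D s t)%E.
Proof.
move=> ss'; apply: ge0_subset_integral => //.
- apply: measurable_funTS; exact: measurable_sqrE_polar_r.
- by move=> x _; exact: sqrE_ge0.
- by apply: subset_itvr; rewrite bnd_simp.
Qed.

Lemma integral_radial_energy_le s (x y : R) : 2^-1 <= s -> y - x <= 2 * pi ->
  (\int[mu]_(t in `[x, y]) radial_energy D s t <=
   20%:E * \int[mu \x mu]_(z in annulus s) sqrE D z)%E.
Proof.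
move=> s12 yx; rewrite radial_energy_swap//.
by apply: polar_le => //; [exact: measurable_sqrE|move=> z; exact: sqrE_ge0].
Qed.

(** An integrable function is finite almost everywhere. Radial limits exist wherever this energy is
    finite, hence at almost every boundary point. *)
Lemma radial_energy_ae (x y : R) : y - x <= 2 * pi ->
  {ae mu, forall t, `[x, y]%classic t -> (radial_energy D 2^-1 t < +oo)%E}.
Proof.
move=> yx.
have mI : measurable (`[x, y]%classic : set T) by exact: measurable_itv.
have iX : mu.-integrable `[x, y] (radial_energy D 2^-1).
  apply/integrableP; split.
    by apply: measurable_funTS; exact: measurable_radial_energy.
  under eq_integral do rewrite gee0_abs ?radial_energy_ge0//.
  apply: (le_lt_trans (integral_radial_energy_le (lexx _) yx)).
  by rewrite lte_mul_pinfty.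
have := integrable_ae mI iX.
apply: filterS => t /[apply]; rewrite ge0_fin_numE//; exact: radial_energy_ge0.
Qed.

(** Limit of [radial_sqr_le] as the outer radius tends to 1; the length of the radius in play stays
    below [1 - s]. *)
Lemma boundary_sqr_le s t r : 2^-1 <= s -> s < r < 1 ->
  (radial_energy D 2^-1 t < +oo)%E ->
  (((b t - p r t) ^+ 2)%:E <= (1 - s)%:E * radial_energy D s t)%E.
Proof.
move=> s12 /andP[sr r1] Xfin.
have Xs : radial_energy D s t \is a fin_num.
  rewrite ge0_fin_numE ?radial_energy_ge0//.
  by rewrite (le_lt_trans _ Xfin)// radial_energy_le.
rewrite -(fineK Xs) -EFinM lee_fin.
set Q := fine _.
have Q0 : 0 <= Q by rewrite fine_ge0// radial_energy_ge0.
have cv : (p r' t - p r t) ^+ 2 @[r' --> 1^'-] --> (b t - p r t) ^+ 2.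
  rewrite expr2; under eq_fun do rewrite expr2.
  by apply: cvgM; apply: cvgB => //; [exact: pb|exact: cvg_cst|exact: pb|exact: cvg_cst].
apply: (cvgr_to_le cv).
near=> r'.
have rr' : r < r' by near: r'; exact: nbhs_left_gt.
have r'1 : r' < 1 by near: r'; exact: nbhs_left_lt.
apply: (@le_trans _ _ ((r' - r) * Q)).
  apply: (radial_sqr_le mD D0 dr (s := s)) => //; first by lra.
    exact: ltW.
  by rewrite /Q fineK.
by rewrite ler_wpM2r//; lra.
Unshelve. all: by end_near. Qed.

(** Let [l = y - x], and let [c] be the value of [p] at the start of the arc on a good circle of
    radius [rho]. In [(b - c)^2 <= 2 (b - p rho)^2 + 2 (p rho - c)^2] the first term integrates to
    at most [2 (1 - s) * 20 w = 10 l w / pi], the second to at most [320 pi w l]. Division by [l]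
    leaves the constant. *)
Lemma oscillation_le (x y w : R) : x < y -> y - x <= 2 * pi -> 0 < w ->
  (\int[mu \x mu]_(z in annulus (1 - (y - x) / (4 * pi))) sqrE D z <= w%:E)%E ->
  ((y - x)^-1%:E * \int[mu]_(t in `]x, y[)
     ((b t - (y - x)^-1 * Rintegral mu `]x, y[ b) ^+ 2)%:E <=
   ((10 / pi + 320 * pi) * w)%:E)%E.
Proof.
move=> xy yx w0 hw; have pi0 := pi_gt0 R.
set l := y - x in yx hw *.
have l0 : 0 < l by rewrite subr_gt0.
set s := 1 - l / (4 * pi) in hw.
have s1 : 1 - s = l / (4 * pi) by rewrite /s; ring.
have sl : 0 < l / (4 * pi) <= 2^-1.
  by rewrite divr_gt0 ?mulr_gt0//= ler_pdivrMr ?mulr_gt0//; lra.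
have s12 : 2^-1 <= s by lra.
have hY := integral_radial_energy_le s12 yx.
have hY20 : (\int[mu]_(t in `[x, y]) radial_energy D s t <= (20 * w)%:E)%E.
  by rewrite (le_trans hY)// EFinM lee_wpmul2l.
(* The energy of the box is at most [20 w]; doubling it gives the strict bound that the choice of a
   radius requires. *)
have [| |rho srho1 hrho] := @exists_good_radius R D mD s x y (40 * w).
- by lra.
- by rewrite -radial_energy_swap// (le_lt_trans hY20)// lte_fin; lra.
set Q := 40 * w / (1 - s) in hrho.
have Q0 : 0 <= Q by rewrite /Q s1 divr_ge0//; [lra|case/andP: sl => /ltW].
have lQ : l * Q = 160 * pi * w.
  have e (P L : R) : P != 0 -> L != 0 -> L * (40 * w / (L / (4 * P))) = 160 * P * w.
    by move=> P0 L0; field; rewrite P0 L0.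
  by rewrite /Q s1 e ?gt_eqF.
have ang t : x <= t <= y -> (p rho t - p rho x) ^+ 2 <= 160 * pi * w.
  by move=> xty; rewrite -lQ; apply: (angular_sqr_le mD D0 dt) => //; lra.
set c := p rho x in ang.
have mI : measurable (`]x, y[%classic : set T) by exact: measurable_itv.
have mIc : measurable (`[x, y]%classic : set T) by exact: measurable_itv.
have muI : mu `]x, y[ = l%:E by rewrite lebesgue_measure_itv/= lte_fin xy.
set K := l * ((10 / pi + 320 * pi) * w).
suff H : (\int[mu]_(t in `]x, y[) ((b t - c) ^+ 2)%:E <= K%:E)%E.
  have := sqr_deviation_le mI muI l0 mb H.
  move=> /(lee_wpmul2l (_ : (0 <= l^-1%:E)%E)) /le_trans; apply.
    by rewrite lee_fin invr_ge0 ltW.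
  by rewrite -EFinM lee_fin /K mulrA mulVf ?mul1r// gt_eqF.
pose F t : \bar R := ((2 * (1 - s))%:E * radial_energy D s t + (320 * pi * w)%:E)%E.
have mX := @measurable_radial_energy R D mD s.
have c1 : 0 <= 2 * (1 - s) by lra.
have c2 : 0 <= 320 * pi * w by nra.
have F0 t : (0 <= F t)%E.
  by rewrite adde_ge0// mule_ge0 ?lee_fin// radial_energy_ge0.
have mF : measurable_fun setT F by apply: emeasurable_funD => //; exact: measurable_funeM.
apply: (@le_trans _ _ (\int[mu]_(t in `]x, y[) F t)%E).
  apply: ae_ge0_le_integral => //.
  - by move=> t _; rewrite lee_fin sqr_ge0.
  - apply/measurable_EFinP; apply: measurable_funTS; apply: measurable_funX.
    exact: measurable_funB.
  - exact: measurable_funTS.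
  have [N [mN N0 NP]] := radial_energy_ae yx.
  exists N; split => // t /= Ht; apply: NP => /= {}Hx; apply: Ht => xty.
  have xty' : x <= t <= y by move: xty; rewrite /= in_itv/= => /andP[/ltW -> /ltW ->].
  have Xt : (radial_energy D 2^-1 t < +oo)%E by apply: Hx; rewrite /= in_itv.
  apply: (@le_trans _ _ (2%:E * ((b t - p rho t) ^+ 2)%:E + 2%:E * ((p rho t - c) ^+ 2)%:E)%E).
    rewrite -!EFinM -EFinD lee_fin.
    set u := b t; set v := p rho t.
    by have := sqr_ge0 (u - v - (v - c)); rewrite !expr2; lra.
  apply: leeD.
    rewrite [(2 * (1 - s))%:E]EFinM -muleA lee_wpmul2l//.
    exact: boundary_sqr_le.
  by rewrite -EFinM lee_fin; have := ang t xty'; lra.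
rewrite ge0_integralD//; last 2 first.
- by move=> t _; rewrite mule_ge0 ?lee_fin// radial_energy_ge0.
- by apply: measurable_funTS; exact: measurable_funeM.
rewrite integral_cst// [X in (_ + _ * X)%E]muI ge0_integralZl//; last 2 first.
- exact: measurable_funTS.
- by move=> t _; exact: radial_energy_ge0.
apply: (@le_trans _ _ ((2 * (1 - s))%:E * (20 * w)%:E + (320 * pi * w)%:E * l%:E)%E).
  rewrite leeD2r//; apply: lee_wpmul2l => //.
  apply: le_trans hY20; apply: ge0_subset_integral => //.
  - exact: measurable_funTS.
  - by move=> t _; exact: radial_energy_ge0.
  - exact: subset_itv_oo_cc.
rewrite -!EFinM -EFinD lee_fin /K s1.
have -> : l * ((10 / pi + 320 * pi) * w) = 2 * (l / (4 * pi)) * (20 * w) + 320 * pi * w * l.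
  have e (P : R) : P != 0 ->
      l * ((10 / P + 320 * P) * w) = 2 * (l / (4 * P)) * (20 * w) + 320 * P * w * l.
    by move=> P0; field.
  by apply: e; rewrite gt_eqF.
by [].
Qed.
End boundary_estimates.

(** * Slices of the quaternions *)

Section quaternion_algebra.
Context {R : realType}.
Implicit Types (x y z i : quaternion R) (a b c d u v : R).

Lemma quatP x y : x 0 0 = y 0 0 -> x 0 1 = y 0 1 -> x 0 2%:R = y 0 2%:R ->
  x 0 3%:R = y 0 3%:R -> x = y.
Proof.
move=> h0 h1 h2 h3; apply/rowP => -[[|[|[|[|k]]]] hk] //.
- by rewrite (_ : Ordinal hk = 0)//; exact/val_inj.
- by rewrite (_ : Ordinal hk = 1)//; exact/val_inj.
- by rewrite (_ : Ordinal hk = 2%:R)//; exact/val_inj.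
- by rewrite (_ : Ordinal hk = 3%:R)//; exact/val_inj.
Qed.

Lemma quatE a b c d : ((quat a b c d 0 0 = a) * (quat a b c d 0 1 = b) *
  (quat a b c d 0 2%:R = c) * (quat a b c d 0 3%:R = d))%type.
Proof. by rewrite !mxE. Qed.

Lemma sum_ord4 (F : 'I_4 -> R) : \sum_(k < 4) F k = F 0 + F 1 + F 2%:R + F 3%:R.
Proof.
rewrite !big_ord_recr big_ord0/= add0r.
by congr (_ + _ + _ + _); congr F; exact/val_inj.
Qed.

Lemma qabs_ge0 x : 0 <= qabs x. Proof. exact: sqrtr_ge0. Qed.

Lemma sqr_qabs x : qabs x ^+ 2 = \sum_(k < 4) x 0 k ^+ 2.
Proof. by rewrite sqr_sqrtr// sumr_ge0// => k _; exact: sqr_ge0. Qed.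

Lemma coord_le_qabs x k : `|x 0 k| <= qabs x.
Proof.
rewrite -sqrtr_sqr ler_wsqrtr// (bigD1 k)//= lerDl sumr_ge0// => j _.
exact: sqr_ge0.
Qed.

(** Limits and differentials live in the max norm; this comparison and [qabs_le_norm] translate them
    to the modulus. *)
Lemma norm_le_qabs x : `|x| <= qabs x.
Proof.
rewrite [leLHS]/Num.Def.normr/= mx_normrE; apply: bigmax_le; first exact: qabs_ge0.
by move=> [i j] _ /=; rewrite ord1; exact: coord_le_qabs.
Qed.

Lemma coord_le_norm x k : `|x 0 k| <= `|x|.
Proof.
rewrite [leRHS]/Num.Def.normr/= mx_normrE.
exact: (@le_bigmax _ _ _ _ (fun ij : 'I_1 * 'I_4 => `|x ij.1 ij.2|) (0, k)).
Qed.

Lemma qabs_le_norm x : qabs x <= 2 * `|x|.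
Proof.
rewrite -(ler_pXn2r (n := 2)) ?nnegrE ?qabs_ge0 ?mulr_ge0//.
rewrite sqr_qabs exprMn (_ : 2 ^+ 2 = 4); last by rewrite -natrX.
apply: (@le_trans _ _ (\sum_(k < 4) `|x| ^+ 2)).
  apply: ler_sum => k _.
  by rewrite -[leLHS]real_normK ?num_real// ler_pXn2r ?nnegrE//; exact: coord_le_norm.
by rewrite sumr_const card_ord mulr_natl.
Qed.

Lemma qabs_eq0 x : qabs x = 0 -> x = 0.
Proof.
move=> x0; apply/eqP; rewrite -normr_le0 -x0; exact: norm_le_qabs.
Qed.

(** Euler's four-square identity. *)
Lemma qabsM x y : qabs (qmul x y) = qabs x * qabs y.
Proof.
apply: (pexpIrn (n := 2)); rewrite ?nnegrE ?mulr_ge0 ?qabs_ge0//.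
rewrite exprMn !sqr_qabs !sum_ord4 /qmul !quatE; ring.
Qed.

Lemma qmulBr x y z : qmul x (y - z) = qmul x y - qmul x z.
Proof. by apply: quatP; rewrite /qmul !mxE /=; ring. Qed.

Lemma qmulDr x y z : qmul x (y + z) = qmul x y + qmul x z.
Proof. by apply: quatP; rewrite /qmul !mxE /=; ring. Qed.

Lemma qmulNr x y : qmul x (- y) = - qmul x y.
Proof. by apply: quatP; rewrite /qmul !mxE /=; ring. Qed.

Lemma qmulZl a x y : qmul (a *: x) y = a *: qmul x y.
Proof. by apply: quatP; rewrite /qmul !mxE /=; ring. Qed.

Lemma qmulDl x y z : qmul (x + y) z = qmul x z + qmul y z.
Proof. by apply: quatP; rewrite /qmul !mxE /=; ring. Qed.

Lemma qmul1 x : qmul qone x = x.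
Proof. by apply: quatP; rewrite /qmul /qone !quatE; ring. Qed.

Lemma im_sphereP i : im_sphere i ->
  i 0 0 = 0 /\ i 0 1 ^+ 2 = 1 - i 0 2%:R ^+ 2 - i 0 3%:R ^+ 2.
Proof.
move=> [i0 i1]; split=> //; have h := sqr_qabs i.
by rewrite sum_ord4 i1 [i 0 0]i0 expr1n expr0n /= add0r in h; lra.
Qed.

Lemma qmulii i x : im_sphere i -> qmul i (qmul i x) = - x.
Proof.
move=> /im_sphereP[i0 i1].
by apply: quatP; rewrite /qmul !quatE mxE i0; ring: i1.
Qed.

Lemma sqr_qabs_slice_point i u v : im_sphere i ->
  qabs (slice_point i u v) ^+ 2 = u ^+ 2 + v ^+ 2.
Proof.
move=> /im_sphereP[i0 i1]; rewrite sqr_qabs sum_ord4 /slice_point /qone /quat !mxE /= i0.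
ring: i1.
Qed.

Lemma qmulKV x y : qabs x != 0 -> qmul (qinv x) (qmul x y) = y.
Proof.
move=> x0; rewrite /qinv qmulZl.
have -> : qmul (qconj x) (qmul x y) = (qabs x ^+ 2) *: y.
  rewrite sqr_qabs sum_ord4.
  by apply: quatP; rewrite /qmul /qconj /qIm /qRe /qone /quat !mxE /=; ring.
by rewrite scalerA mulVf ?scale1r// expf_neq0.
Qed.

Lemma qabsZ a y : qabs (a *: y) = `|a| * qabs y.
Proof.
apply: (pexpIrn (n := 2)); rewrite ?nnegrE ?mulr_ge0 ?qabs_ge0//.
by rewrite exprMn real_normK ?num_real// !sqr_qabs !sum_ord4 !mxE; ring.
Qed.

Lemma qabs_qinv x : qabs (qinv x) = (qabs x)^-1.
Proof.
have c : qabs (qconj x) = qabs x.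
  apply: (pexpIrn (n := 2)); rewrite ?nnegrE ?qabs_ge0//.
  by rewrite !sqr_qabs !sum_ord4 /qconj /qIm /qRe /qone /quat !mxE /=; ring.
have [x0|xN0] := eqVneq (qabs x) 0.
  rewrite x0 invr0 /qinv x0 expr0n invr0 scale0r.
  by rewrite /qabs big1 ?sqrtr0// => k _; rewrite mxE expr0n.
rewrite /qinv qabsZ c ger0_norm ?invr_ge0 ?sqr_ge0//.
by field.
Qed.

Lemma im_unit_sphere x : im_sphere (im_unit x).
Proof.
rewrite /im_unit; case: ifPn => [_|x0].
  split; first by rewrite /qRe quatE.
  by rewrite /qabs sum_ord4 !quatE expr0n expr1n !addr0 add0r sqrtr1.
have ax : qabs (qIm x) != 0 by apply: contra x0 => /eqP /qabs_eq0 ->.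
split.
  by rewrite /qRe /qIm /qone /quat /qRe !mxE /= mulr1 subrr mulr0.
by rewrite qabsZ ger0_norm ?invr_ge0 ?qabs_ge0// mulVf.
Qed.

Lemma slice_point_im_unit x : x = slice_point (im_unit x) (qRe x) (qabs (qIm x)).
Proof.
rewrite /slice_point /im_unit; case: ifPn => [/eqP x0|x0].
  have -> : qabs (qIm x) = 0.
    by rewrite x0 /qabs big1 ?sqrtr0// => k _; rewrite mxE expr0n.
  by rewrite scale0r addr0 -[LHS](subrK (qRe x *: qone)) -/(qIm x) x0 add0r.
have ax : qabs (qIm x) != 0 by apply: contra x0 => /eqP /qabs_eq0 ->.
by rewrite scalerA mulfV// scale1r /qIm addrC subrK.
Qed.

Lemma qRe_slice_point i u v : im_sphere i -> qRe (slice_point i u v) = u.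
Proof.
by move=> /im_sphereP[i0 _]; rewrite /qRe /slice_point /qone /quat !mxE /= i0; ring.
Qed.

Lemma qIm_slice_point i u v : im_sphere i -> qIm (slice_point i u v) = v *: i.
Proof. by move=> iS; rewrite /qIm qRe_slice_point// /slice_point addrC addKr. Qed.

Lemma qabs_qIm_slice_point i u v : im_sphere i -> qabs (qIm (slice_point i u v)) = `|v|.
Proof. by move=> iS; rewrite qIm_slice_point// qabsZ; case: iS => _ ->; rewrite mulr1. Qed.

Lemma slice_point_ball i u v : im_sphere i ->
  unit_ball (slice_point i u v) <-> unit_disc (u, v).
Proof.
move=> iS; rewrite /unit_ball /unit_disc/= -(sqr_qabs_slice_point u v iS).
by rewrite expr_lt1// qabs_ge0.
Qed.

End quaternion_algebra.

(** * Cauchy-Riemann equations as linearity of the differential on a slice *)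

Section slice_differential.
Context {R : realType}.
Implicit Types (f : quaternion R -> quaternion R) (i x : quaternion R) (u v t : R).

Lemma is_derive_row (g : R -> quaternion R) t (dg : quaternion R) :
  (forall k, is_derive t 1 (fun s => g s 0 k) (dg 0 k)) -> is_derive t 1 g dg.
Proof.
move=> h; have dgt : derivable g t 1.
  by apply/derivable_mxP => i k; rewrite ord1; exact: ex_derive.
apply: DeriveDef => //; rewrite derive_mx//.
by apply/rowP => k; rewrite mxE; exact: derive_val.
Qed.

Lemma is_derive_coord (g : R -> quaternion R) t (dg : quaternion R) k :
  is_derive t 1 g dg -> is_derive t 1 (fun s => g s 0 k) (dg 0 k).
Proof.
move=> [dgt <-]; have /derivable_mxP h := dgt.
by apply: DeriveDef => //; rewrite derive_mx// mxE.
Qed.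

Lemma is_derive_qmul x (g : R -> quaternion R) t (dg : quaternion R) :
  is_derive t 1 g dg -> is_derive t 1 (fun s => qmul x (g s)) (qmul x dg).
Proof.
move=> h; have hk k := is_derive_coord k h.
apply: is_derive_row => -[[|[|[|[|k]]]] hkk] //.
- rewrite (_ : Ordinal hkk = 0); last exact/val_inj.
  under eq_fun do rewrite quatE.
  by apply: is_derive_eq; rewrite quatE /GRing.scale/=; ring.
- rewrite (_ : Ordinal hkk = 1); last exact/val_inj.
  under eq_fun do rewrite quatE.
  by apply: is_derive_eq; rewrite quatE /GRing.scale/=; ring.
- rewrite (_ : Ordinal hkk = 2%:R); last exact/val_inj.
  under eq_fun do rewrite quatE.
  by apply: is_derive_eq; rewrite quatE /GRing.scale/=; ring.
- rewrite (_ : Ordinal hkk = 3%:R); last exact/val_inj.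
  under eq_fun do rewrite quatE.
  by apply: is_derive_eq; rewrite quatE /GRing.scale/=; ring.
Qed.

Lemma is_derive_line (V W : normedModType R) (f : V -> W) (c : R -> V) e t :
  (forall h, c (h + t) = h *: e + c t) -> differentiable f (c t) ->
  is_derive t 1 (f \o c) ('d f (c t) e).
Proof.
move=> ce df.
have E : (fun h : R => h^-1 *: (((f \o c) \o shift t) (h *: 1) - (f \o c) t)) =
    (fun h : R => h^-1 *: ((f \o shift (c t)) (h *: e) - f (c t))).
  by apply/funext => h /=; rewrite -[h *: 1]/(h * 1) mulr1 ce.
have dfe : derivable f (c t) e by exact: diff_derivable.
apply: DeriveDef; first by rewrite /derivable E.
by rewrite /derive E -deriveE.
Qed.

Lemma unit_disc_nearl u v : unit_disc (u, v) -> \forall u' \near u, unit_disc (u', v).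
Proof.
rewrite /unit_disc/= => uv.
have c : (fun x : R => x ^+ 2 + v ^+ 2) @ u --> u ^+ 2 + v ^+ 2.
  by apply: cvgD; [exact: exprn_continuous|exact: cvg_cst].
exact: (cvgr_lt _ c _ uv).
Qed.

Lemma unit_disc_nearr u v : unit_disc (u, v) -> \forall v' \near v, unit_disc (u, v').
Proof.
rewrite /unit_disc/= => uv.
have c : (fun x : R => u ^+ 2 + x ^+ 2) @ v --> u ^+ 2 + v ^+ 2.
  by apply: cvgD; [exact: cvg_cst|exact: exprn_continuous].
exact: (cvgr_lt _ c _ uv).
Qed.

Lemma im_sphere_neq0 i : im_sphere i -> i != 0.
Proof.
move=> /im_sphereP[i0 i1]; apply/eqP => i_0.
by move: i1; rewrite i_0 !mxE expr0n/= !subr0 => /eqP; rewrite eq_sym oner_eq0.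
Qed.

(** [SH_L] describes [f] through [|v|] and the unit [im_unit]. For [v < 0] that unit is [- i], and
    the parities of [alpha] and [beta] absorb both signs. *)
Lemma slice_formula f (alpha beta : R -> R -> quaternion R) i u v :
  (forall x, unit_ball x -> f x = alpha (qRe x) (qabs (qIm x))
     + qmul (im_unit x) (beta (qRe x) (qabs (qIm x)))) ->
  alpha u (- v) = alpha u v -> beta u (- v) = - beta u v ->
  im_sphere i -> unit_disc (u, v) ->
  f (slice_point i u v) = alpha u v + qmul i (beta u v).
Proof.
move=> hf ha hb iS uv; rewrite hf; last exact/slice_point_ball.
rewrite qRe_slice_point// qabs_qIm_slice_point//.
have qmul0 x : qmul x 0 = 0 :> quaternion R.
  by apply: quatP; rewrite /qmul !mxE /=; ring.
have [v0|v0|v0] := ltgtP v 0.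
- rewrite ltr0_norm// ha hb; congr (_ + _).
  have -> : im_unit (slice_point i u v) = (-1) *: i.
    rewrite /im_unit qIm_slice_point// scaler_eq0 (lt_eqF v0)/= (negbTE (im_sphere_neq0 iS)).
    rewrite qabsZ; case: iS => _ ->; rewrite mulr1 ltr0_norm// scalerA.
    by rewrite invrN mulNr mulVf ?lt_eqF.
  by rewrite qmulZl qmulNr scaleN1r opprK.
- rewrite gtr0_norm//; congr (_ + qmul _ _).
  rewrite /im_unit qIm_slice_point// scaler_eq0 (gt_eqF v0)/= (negbTE (im_sphere_neq0 iS)).
  rewrite qabsZ; case: iS => _ ->; rewrite mulr1 gtr0_norm// scalerA.
  by rewrite mulVf ?gt_eqF// scale1r.
(* At a real point [beta] vanishes by oddness, so the conventional unit chosen by [im_unit] has no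
   effect. *)
- have -> : beta u `|v| = 0.
    move: hb; rewrite v0 oppr0 normr0 => /eqP; rewrite -addr_eq0 -mulr2n -scaler_nat.
    by rewrite scaler_eq0 pnatr_eq0/= => /eqP.
  have -> : beta u v = 0.
    move: hb; rewrite v0 oppr0 => /eqP; rewrite -addr_eq0 -mulr2n -scaler_nat.
    by rewrite scaler_eq0 pnatr_eq0/= => /eqP.
  by rewrite !qmul0 v0 normr0.
Qed.

(** By real linearity it suffices to treat the directions [1] and [i]; the Cauchy-Riemann equations
    and [i * i = -1] turn the derivative along [i] into [i] times the derivative along [1]. *)
Lemma diff_slice f i u v a b : SH_L f -> im_sphere i -> unit_disc (u, v) ->
  'd f (slice_point i u v) (slice_point i a b) =
  qmul (slice_point i a b) ('d f (slice_point i u v) qone).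
Proof.
move=> [df [alpha [beta [hf hab]]]] iS uv.
have {}df : differentiable f (slice_point i u v) by apply: df; exact/slice_point_ball.
have [ha hb [d1 d2 d3 d4] CR1 CR2] := hab u v uv.
have form u' v' : unit_disc (u', v') ->
    f (slice_point i u' v') = alpha u' v' + qmul i (beta u' v').
  by move=> uv'; have [? ? _ _ _] := hab _ _ uv'; exact: slice_formula.
have D1 : 'd f (slice_point i u v) qone =
    'D_1 (alpha ^~ v) u + qmul i ('D_1 (beta ^~ v) u).
  have [_ <-] : is_derive u 1 (f \o (fun u => slice_point i u v))
      ('d f (slice_point i u v) qone).
    by apply: is_derive_line => // h; rewrite /slice_point scalerDl addrA.
  rewrite (@near_eq_derive _ _ _ _ (fun u => alpha u v + qmul i (beta u v))).
    have h3 : is_derive u 1 (beta ^~ v) ('D_1 (beta ^~ v) u) := DeriveDef d3 erefl.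
    have h1 : is_derive u 1 (alpha ^~ v) ('D_1 (alpha ^~ v) u) := DeriveDef d1 erefl.
    have h4 := is_derive_qmul i h3.
    by have [_ ->] := is_deriveD h1 h4.
  by have := unit_disc_nearl uv; apply: filterS => u' /form.
have D2 : 'd f (slice_point i u v) i =
    'D_1 (alpha u) v + qmul i ('D_1 (beta u) v).
  have [_ <-] : is_derive v 1 (f \o (fun v => slice_point i u v))
      ('d f (slice_point i u v) i).
    by apply: is_derive_line => // h; rewrite /slice_point scalerDl addrCA.
  rewrite (@near_eq_derive _ _ _ _ (fun v => alpha u v + qmul i (beta u v))).
    have h3 : is_derive v 1 (beta u) ('D_1 (beta u) v) := DeriveDef d4 erefl.
    have h1 : is_derive v 1 (alpha u) ('D_1 (alpha u) v) := DeriveDef d2 erefl.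
    have h4 := is_derive_qmul i h3.
    by have [_ ->] := is_deriveD h1 h4.
  by have := unit_disc_nearr uv; apply: filterS => v' /form.
have D3 : 'd f (slice_point i u v) i = qmul i ('d f (slice_point i u v) qone).
  rewrite D2 D1 CR1 CR2; move: ('D_1 (beta u) v) ('D_1 (alpha u) v) => y z.
  by rewrite qmulDr qmulNr qmulNr qmulii// opprK addrC.
rewrite /slice_point linearD !linearZ/= -/(slice_point i u v) D3.
by rewrite qmulDl !qmulZl qmul1.
Qed.

End slice_differential.

(** * The slice derivative, and the derivatives in polar coordinates *)

Section polar_derivatives.
Context {R : realType}.
Implicit Types (f : quaternion R -> quaternion R) (i x : quaternion R) (u v t r : R).

(** Real translations stay in the slice, so none of its points is isolated; properness makes the
    limit that defines [slice_derivative] unique. *)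
Lemma within_slice_proper i x : slice i x -> ProperFilter (within (slice i) x^').
Proof.
move=> [u [v ->]]; apply: Build_ProperFilter_ex => A.
rewrite /within/= => /(nbhs_ballP (slice_point i u v))[e /= e0 eA].
pose p := slice_point i (u + e / 2) v.
have pE : p = slice_point i u v + (e / 2) *: qone.
  by rewrite /p /slice_point scalerDl addrAC.
have n1 : `|qone| <= 1 :> R.
  rewrite (le_trans (norm_le_qabs _))// /qabs sum_ord4 /qone !quatE expr1n expr0n.
  by rewrite !addr0 sqrtr1.
exists p; apply: eA.
- rewrite -ball_normE /= pE opprD addNKr normrN normrZ.
  rewrite gtr0_norm ?divr_gt0// (le_lt_trans (_ : _ <= e / 2))//; last lra.
  by rewrite ger_pMr// divr_gt0.
- rewrite pE -subr_eq0 addrC addKr scaler_eq0 mulf_eq0 invr_eq0 (gt_eqF e0) pnatr_eq0/=.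
  apply/eqP => /rowP/(_ 0); rewrite !mxE /= => /eqP; by rewrite oner_eq0.
- by exists (u + e / 2), v.
Qed.

(** For an increment [h] in the slice, ['d f x h] is [h] times ['d f x qone] by [diff_slice]; left
    division by [h] divides the modulus of the remainder by that of [h]. *)
Lemma slice_derivativeE f x : SH_L f -> unit_ball x ->
  slice_derivative f x = 'd f x qone.
Proof.
move=> Hf xB; set j := im_unit x.
have jS : im_sphere j by exact: im_unit_sphere.
have xE := slice_point_im_unit x; rewrite -/j in xE.
set u := qRe x in xE; set v := qabs (qIm x) in xE.
have uv : unit_disc (u, v) by apply/(slice_point_ball u v jS); rewrite -xE.
have df : differentiable f x by case: Hf => + _; exact.
have sx : slice j x by exists u, v.
have PF := within_slice_proper sx.
apply: cvg_lim; first exact: norm_hausdorff.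
apply/cvgrPdist_le => e e0.
(* Half of [e], because the modulus is at most twice the max norm. *)
have /eqaddoP/(_ (e / 2)) H := diff_locally df.
have /(nbhs_ballP (0 : quaternion R))[d d0 dH] := H (divr_gt0 e0 (ltr0n _ 2)).
rewrite /within/=; apply/(nbhs_ballP x); exists d => //= p xp pNx [a [b pE]].
set h := p - x.
have hE : h = slice_point j (a - u) (b - v).
  by rewrite /h (pE : p = slice_point j a b)
     [X in _ - X]xE /slice_point !scalerBl opprD addrACA.
have hN0 : h != 0 by rewrite subr_eq0.
have h0 : qabs h != 0 by apply: contra hN0 => /eqP/qabs_eq0 ->.
have dfh : 'd f x h = qmul h ('d f x qone).
  by rewrite hE; have := diff_slice (a - u) (b - v) Hf jS uv; rewrite -xE.
have := dH h; rewrite -ball_normE /= sub0r normrN.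
have hd : `|h| < d by move: xp; rewrite -ball_normE/= distrC.
move=> /(_ hd); rewrite !fctE /= subrK dfh => rle.
rewrite -{1}(qmulKV ('d f x qone) h0) -qmulBr.
rewrite (le_trans (norm_le_qabs _))// qabsM qabs_qinv mulrC ler_pdivrMr; last first.
  by rewrite lt_def h0 qabs_ge0.
apply: (le_trans (qabs_le_norm _)).
rewrite distrC -opprB opprB.
have -> : f p - f x - qmul h ('d f x qone) = f p - (f x + qmul h ('d f x qone)).
  by rewrite opprD addrA.
have hq := norm_le_qabs h.
rewrite -ler_pdivlMl// (le_trans rle)// mulrA [2^-1 * e]mulrC ler_wpM2l//.
by rewrite divr_ge0// ltW.
Qed.

(** Serves as the dominating function [D] of the preceding estimates; the extension by 0 makes it
    measurable on the whole plane. *)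
Definition slice_norm f i (z : R * R) : R :=
  ((fun z => qabs (slice_derivative f (slice_point i z.1 z.2))) \_ unit_disc) z.

Lemma polar_slice_point i r t :
  r *: qexp i t = slice_point i (r * cos t) (r * sin t).
Proof. by rewrite /qexp /slice_point scalerDr !scalerA. Qed.

Lemma polar_disc r t : 0 <= r < 1 -> unit_disc (polar_map (r, t)).
Proof.
move=> /andP[r0 r1]; rewrite /unit_disc /polar_map/= !exprMn -mulrDr cos2Dsin2 mulr1.
by rewrite expr_lt1.
Qed.

Lemma slice_norm_polar f i r t : SH_L f -> im_sphere i -> 0 <= r < 1 ->
  slice_norm f i (polar_map (r, t)) = qabs ('d f (r *: qexp i t) qone).
Proof.
move=> Hf iS r01; have pd := polar_disc t r01.
rewrite /slice_norm patchE mem_set// polar_slice_point/= slice_derivativeE//.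
exact/(slice_point_ball _ _ iS).
Qed.

(** The modulus is multiplicative and the direction has modulus at most 1. This covers the radial
    direction, of modulus 1, and the angular one, of modulus [r]. *)
Lemma diff_polar_le f i r t a b k : SH_L f -> im_sphere i -> 0 <= r < 1 ->
  a ^+ 2 + b ^+ 2 <= 1 ->
  `|'d f (r *: qexp i t) (slice_point i a b) 0 k| <= slice_norm f i (polar_map (r, t)).
Proof.
move=> Hf iS r01 ab1; rewrite slice_norm_polar//.
have pd := polar_disc t r01.
rewrite polar_slice_point diff_slice// (le_trans (coord_le_qabs _ _))// qabsM.
rewrite ler_piMl ?qabs_ge0// -(expr_le1 (n := 2)) ?qabs_ge0//.
by rewrite sqr_qabs_slice_point.
Qed.

Lemma differentiable_polar f i r t : SH_L f -> im_sphere i -> 0 <= r < 1 ->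
  differentiable f (r *: qexp i t).
Proof.
move=> [df _] iS r01; apply: df; rewrite polar_slice_point.
by apply/(slice_point_ball _ _ iS); exact: polar_disc.
Qed.

Lemma derive_polar_r f i r t k : SH_L f -> im_sphere i -> 0 < r < 1 ->
  derivable (fun r => f (r *: qexp i t) 0 k) r 1 /\
  `|'D_1 (fun r => f (r *: qexp i t) 0 k) r| <= slice_norm f i (polar_map (r, t)).
Proof.
move=> Hf iS /andP[r0 r1]; have r01 : 0 <= r < 1 by rewrite ltW.
have H : is_derive r 1 (f \o (fun r => r *: qexp i t)) ('d f (r *: qexp i t) (qexp i t)).
  apply: is_derive_line; last exact: differentiable_polar.
  by move=> h; rewrite scalerDl.
have [d1 d2] := is_derive_coord k H; split; first exact: d1.
rewrite [X in `|X|]d2; apply: diff_polar_le => //.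
by rewrite cos2Dsin2.
Qed.

Lemma derive_polar_t f i r t k : SH_L f -> im_sphere i -> 0 < r < 1 ->
  derivable (fun t => f (r *: qexp i t) 0 k) t 1 /\
  `|'D_1 (fun t => f (r *: qexp i t) 0 k) t| <= slice_norm f i (polar_map (r, t)).
Proof.
move=> Hf iS /andP[r0 r1]; have r01 : 0 <= r < 1 by rewrite ltW.
pose c t := r *: qexp i t.
have dc : is_derive t 1 c (slice_point i (- (r * sin t)) (r * cos t)).
  apply: is_derive_row => j.
  have -> : (fun s => c s 0 j) = (fun s => r * (cos s * qone 0 j + sin s * i 0 j)).
    by apply/funext => s; rewrite /c /qexp /slice_point !mxE.
  apply: is_derive_eq; rewrite /slice_point !mxE /GRing.scale/=; ring.
have dfc : differentiable f (c t) by exact: differentiable_polar.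
have [dc1 dc2] := dc.
have dct : differentiable c t by apply/derivable1_diffP.
have H : is_derive t 1 (f \o c) ('d f (c t) (slice_point i (- (r * sin t)) (r * cos t))).
  apply: DeriveDef; first by apply/derivable1_diffP; exact: differentiable_comp.
  rewrite deriveE; last exact: differentiable_comp.
  by rewrite diff_comp//= -dc2 deriveE.
have [d1 d2] := is_derive_coord k H; split; first exact: d1.
rewrite [X in `|X|]d2; apply: diff_polar_le => //.
rewrite sqrrN !exprMn -mulrDr addrC cos2Dsin2 mulr1.
by rewrite expr_le1// ltW.
Qed.

End polar_derivatives.

(** * Measurability and radial boundary values *)

Section measurability.
Context {R : realType}.
Notation mu := (@lebesgue_measure R).
Notation T := (measurableTypeR R).

(** [U] is the union of the countably many boxes with rational centre and radius [1 / (n + 1)] that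
    it contains. This links the product topology to the product sigma-algebra. *)
Lemma open_prod_measurable (U : set (R * R)) : open U -> measurable (U : set (T * T)).
Proof.
move=> oU.
pose box (p : rat * rat * nat) : set (T * T) :=
  (ball (ratr p.1.1 : R) p.2.+1%:R^-1 : set T) `*`
  (ball (ratr p.1.2 : R) p.2.+1%:R^-1 : set T).
have -> : U = \bigcup_p (if pselect (box p `<=` U) then box p else set0).
  apply/seteqP; split => [[x y] Uxy|z [p _]]; last by case: pselect => //; apply.
  have /(nbhs_ballP (x, y))[e /= e0 eU] : nbhs (x, y) U by exact: open_nbhs_nbhs.
  (* Half of [e]: a point of the box is reached from [(x, y)] in two steps shorter than the radius,
     through the rational centre. *)
  have [n] : exists n : nat, n.+1%:R^-1 < e / 2.
    exists (Num.truncn (e / 2)^-1).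
    rewrite -[ltRHS]invrK ltf_pV2 ?posrE ?invr_gt0 ?divr_gt0//.
    exact: truncnS_gt.
  set d := n.+1%:R^-1 => de.
  have d0 : 0 < d by rewrite invr_gt0.
  have near_rat (w : R) : exists q : rat, `|ratr q - w| < d.
    have wd : w - d < w + d by lra.
    have [q] := rat_in_itvoo wd.
    rewrite in_itv/= => /andP[q1 q2]; exists q.
    by rewrite ltr_norml; apply/andP; split; lra.
  have [q hq] := near_rat x; have [q' hq'] := near_rat y.
  exists (q, q', n) => //.
  case: pselect => [h|nbox]; first by split.
  exfalso; apply: nbox => -[x' y'] [/= hx hy]; apply: eU; split => /=.
    rewrite /ball/= in hx *.
    have := ler_normD (x - ratr q) (ratr q - x'); rewrite subrKA distrC in hq * => h.
    by rewrite (le_lt_trans h)//; move: hx hq; rewrite -/d; lra.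
  rewrite /ball/= in hy *.
  have := ler_normD (y - ratr q') (ratr q' - y'); rewrite subrKA distrC in hq' * => h.
  by rewrite (le_lt_trans h)//; move: hy hq'; rewrite -/d; lra.
apply: countable_bigcupT_measurable => [|p]; first exact: countableP.
case: pselect => [h|h]; last exact: measurable0.
by apply: measurableX; exact: measurable_ball.
Qed.

Lemma open_continuous_prod_measurable_fun (U : set (R * R)) (F : R * R -> R) :
  open U -> {in U, continuous F} -> measurable_fun (U : set (T * T)) (F : T * T -> T).
Proof.
move=> oU cF; apply: (measurability _ (RGenOpens.measurableE R)) => //.
move=> _ [_ [a [b ->] <-]]; apply: open_prod_measurable.
rewrite openE => z [Uz abz].
have Uz' : nbhs z U by exact: open_nbhs_nbhs.
have nab : nbhs (F z) `]a, b[%classic.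
  by apply: open_nbhs_nbhs; split => //; exact: interval_open.
have := cF z (mem_set Uz) _ nab.
by move=> h; exact: (filterI Uz' h).
Qed.

Lemma unit_disc_open : open (@unit_disc R).
Proof.
have -> : unit_disc = (fun z : R * R => z.1 ^+ 2 + z.2 ^+ 2) @^-1` [set x | x < 1].
  by [].
apply: open_comp; last exact: open_lt.
move=> z _; apply: cvgD.
- by apply: (cvg_comp fst (fun x : R => x ^+ 2)); [exact: cvg_fst|exact: exprn_continuous].
- by apply: (cvg_comp snd (fun x : R => x ^+ 2)); [exact: cvg_snd|exact: exprn_continuous].
Qed.

End measurability.

Section slice_norm_measurable.
Context {R : realType}.
Notation mu := (@lebesgue_measure R).
Notation T := (measurableTypeR R).

(** On the disc the slice derivative is the derivative in the real direction, a pointwise limit of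
    difference quotients of the continuous function [f]. *)
Lemma measurable_slice_norm (f : quaternion R -> quaternion R) i :
  SH_L f -> im_sphere i -> measurable_fun setT (slice_norm f i : T * T -> T).
Proof.
move=> Hf iS.
have mdisc : measurable (unit_disc : set (T * T)).
  by apply: open_prod_measurable; exact: unit_disc_open.
have dfz z : unit_disc z -> differentiable f (slice_point i z.1 z.2).
  by case: z => u v uv; case: Hf => + _; apply; exact/(slice_point_ball _ _ iS).
pose F k : T * T -> T := (fun z => f (slice_point i z.1 z.2) 0 k) \_ unit_disc.
have mF k : measurable_fun setT (F k).
  apply/measurable_restrict => //; rewrite setTI.
  apply: open_continuous_prod_measurable_fun; first exact: unit_disc_open.
  move=> z /[!inE] zd.
  have c1 : (fun z : R * R => slice_point i z.1 z.2) @ z --> slice_point i z.1 z.2.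
    apply: cvgD.
    - by apply: cvgZr_tmp; exact: cvg_fst.
    - by apply: cvgZr_tmp; exact: cvg_snd.
  have c2 : {for slice_point i z.1 z.2, continuous f}.
    by apply: differentiable_continuous; exact: dfz.
  have c3 : (fun z => f (slice_point i z.1 z.2)) @ z --> f (slice_point i z.1 z.2).
    exact: (cvg_comp _ _ c1 c2).
  exact: (cvg_comp _ _ c3 (@coord_continuous _ _ _ _ _ _)).
pose d k (z : T * T) : T := 'd f (slice_point i z.1 z.2) qone 0 k.
have md k : measurable_fun unit_disc (d k).
  (* The shifted point may leave the disc, hence the extension [F] by 0; for fixed [z] it is inside
     as soon as [n] is large. *)
  pose h (n : nat) (z : T * T) : T := n.+1%:R * (F k (z.1 + n.+1%:R^-1, z.2) - F k z).
  apply: (@measurable_fun_cvg _ _ _ _ h).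
    move=> n; apply: measurable_funTS; apply: measurable_funM => //.
    apply: measurable_funB; last exact: mF.
    have m1 : measurable_fun setT (fun z : T * T => (z.1 + n.+1%:R^-1, z.2) : T * T).
      by apply: measurable_fun_pair => //; exact: measurable_funD.
    exact: (measurableT_comp (mF k) m1).
  move=> z; move: (z : R * R) => [u v] uv.
  have H : is_derive u 1 (f \o (fun u => slice_point i u v)) ('d f (slice_point i u v) qone).
    apply: is_derive_line; last exact: (dfz (u, v)).
    by move=> h0; rewrite /slice_point scalerDl addrA.
  have [d1 d2] := is_derive_coord k H.
  have c1 : n.+1%:R^-1^-1 *: (f (slice_point i (n.+1%:R^-1 *: 1 + u) v) 0 k
      - f (slice_point i u v) 0 k) @[n --> \oo] --> d k (u, v).
    rewrite /d -d2; move: d1 => /cvgr_dnbhsP; apply; split; last exact: cvg_harmonic.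
    by move=> n; rewrite invr_neq0.
  apply: cvg_trans c1; apply: near_eq_cvg.
  have c2 : u + n.+1%:R^-1 @[n --> \oo] --> u.
    rewrite -[X in _ --> X]addr0; apply: cvgD; first exact: cvg_cst.
    exact: cvg_harmonic.
  have := c2 _ (unit_disc_nearl uv); rewrite /nbhs/= => nd.
  near=> n.
  have un : unit_disc (u + n.+1%:R^-1, v) by near: n; exact: nd.
  rewrite /h /F !patchE !mem_set//= invrK /GRing.scale/= mulr1.
  by rewrite [n.+1%:R^-1 + u]addrC.
pose g z : T := Num.sqrt (\sum_(k < 4) d k z ^+ 2).
have mg : measurable_fun unit_disc g.
  have mq : measurable_fun unit_disc (fun z => \sum_(k < 4) d k z ^+ 2 : T).
    by apply: measurable_sum => k; exact: (measurable_funX _ (md k)).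
  exact: (measurableT_comp measurable_sqrt_T mq).
apply/(measurable_restrict _ mdisc measurableT); rewrite setTI.
apply: eq_measurable_fun mg => z; move: (z : R * R) => [u v] /[!inE] uv.
by rewrite slice_derivativeE//; exact/(slice_point_ball _ _ iS).
Unshelve. all: by end_near. Qed.

Lemma slice_norm_ge0 (f : quaternion R -> quaternion R) i z : 0 <= slice_norm f i z.
Proof. by rewrite /slice_norm patchE; case: ifP => // _; exact: qabs_ge0. Qed.

Lemma cvg_row (F : set_system R) (FF : ProperFilter F) (g : R -> quaternion R)
    (l : quaternion R) :
  (forall k, g r 0 k @[r --> F] --> l 0 k) -> g r @[r --> F] --> l.
Proof.
move=> h; apply/cvgrPdist_le => e e0.
have : \forall r \near F, forall k, `|l 0 k - g r 0 k| <= e.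
  by apply: filter_forall => k; move/cvgrPdist_le : (h k); apply.
apply: filterS => r hr; rewrite [leLHS]/Num.Def.normr/= mx_normrE.
apply: bigmax_le; first exact: ltW.
by move=> [a k] _ /=; rewrite ord1 !mxE; exact: hr.
Qed.

End slice_norm_measurable.

(** * Integrals of functions that agree off a null set *)

Section negligible_integral.
Context d (X : measurableType d) {R : realType} (m : {measure set X -> \bar R}).
Import HBNNSimple.

(** The integral is a supremum over simple functions. If [h] is below [f], then [h] cut to 0 on [N]
    is below [g] and has the same integral as [h]. *)
Lemma le_integral_negligible (D N : set X) (f g : X -> \bar R) :
  measurable D -> measurable N -> m N = 0%E ->
  (forall x, 0 <= f x)%E -> (forall x, 0 <= g x)%E ->
  (forall x, D x -> ~ N x -> f x = g x) ->
  (\int[m]_(x in D) f x <= \int[m]_(x in D) g x)%E.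
Proof.
move=> mD mN N0 f0 g0 fg.
rewrite !ge0_integralE; [|by move=> x _; exact: g0|by move=> x _; exact: f0].
apply: ge_ereal_sup => _ [h /= hf <-].
have mNC : measurable (~` N) by exact: measurableC.
apply: le_ereal_sup_tmp; exists (sintegral m (proj_nnsfun h mNC)).
  exists (proj_nnsfun h mNC) => // x /=.
  rewrite mindicE; case: (boolP (x \in ~` N)) => [xN|_]; last first.
    by rewrite mulr0; apply: erestrict_ge0 => y _; exact: g0.
  rewrite mulr1; have := hf x; rewrite !patchE; case: ifPn => // /[!inE] Dx.
  by rewrite fg//; move: xN; rewrite inE.
have mh : measurable_fun setT (EFin \o h).
  by apply/measurable_EFinP.
rewrite -!integralT_nnsfun.
rewrite (@ge0_negligible_integral _ _ _ m setT N)//; last by move=> x _; rewrite lee_fin.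
rewrite integral_mkcond [leRHS](_ : _ = \int[m]_x ((EFin \o h) \_ (setT `\` N)) x)%E//.
apply: eq_integral => x _; rewrite patchE /= mindicE setTD.
by case: ifPn => xN; rewrite ?mulr1 ?mulr0.
Qed.

(** Unlike [ae_eq_integral], this asks no measurability of [f] and [g]: boundary
    values are only known to be measurable off a negligible set. *)
Lemma eq_integral_negligible (D N : set X) (f g : X -> \bar R) :
  measurable D -> measurable N -> m N = 0%E ->
  (forall x, D x -> ~ N x -> f x = g x) ->
  (\int[m]_(x in D) f x = \int[m]_(x in D) g x)%E.
Proof.
move=> mD mN N0 fg.
have H (f' g' : X -> \bar R) : (forall x, 0 <= f' x)%E -> (forall x, 0 <= g' x)%E ->
    (forall x, D x -> ~ N x -> f' x = g' x) ->
    (\int[m]_(x in D) f' x = \int[m]_(x in D) g' x)%E.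
  move=> f0 g0 e; apply: le_anti; rewrite (le_integral_negligible mD mN N0 f0 g0 e)/=.
  by apply: (le_integral_negligible mD mN N0) => // x Dx Nx; rewrite e.
rewrite integralE [RHS]integralE; congr (_ - _)%E; apply: H => //.
- by move=> x Dx Nx; rewrite !funeposE fg.
- by move=> x Dx Nx; rewrite !funenegE fg.
Qed.

End negligible_integral.

(** * Tails of the Dirichlet integral, radial limits and the trace *)

Section trace.
Context {R : realType}.
Notation mu := (@lebesgue_measure R).
Notation T := (measurableTypeR R).
Variables (f : quaternion R -> quaternion R) (i : quaternion R).
Hypothesis Hf : SH_L f.
Hypothesis iS : im_sphere i.
Hypothesis Efin : (dirichlet_integral f i < +oo)%E.

Let Dn : T * T -> R := slice_norm f i.
Let P k (r t : R) := f (r *: qexp i t) 0 k.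

Let mDn : measurable_fun setT (Dn : T * T -> T).
Proof. exact: measurable_slice_norm. Qed.

Let Dn0 z : 0 <= Dn z. Proof. exact: slice_norm_ge0. Qed.

Let drP k r t : 0 < r < 1 ->
  derivable (P k ^~ t) r 1 /\ `|'D_1 (P k ^~ t) r| <= Dn (polar_map (r, t)).
Proof. exact: derive_polar_r. Qed.

Let dtP k r t : 0 < r < 1 ->
  derivable (P k r) t 1 /\ `|'D_1 (P k r) t| <= Dn (polar_map (r, t)).
Proof. exact: derive_polar_t. Qed.

Lemma annulus_sub_disc (s : R) : annulus s `<=` unit_disc.
Proof. by move=> z /andP[]. Qed.

Lemma measurable_unit_disc : measurable (unit_disc : set (T * T)).
Proof. by apply: open_prod_measurable; exact: unit_disc_open. Qed.

Lemma annulus_energy_le_dirichlet s :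
  (\int[mu \x mu]_(z in annulus s) sqrE (slice_norm f i) z <= dirichlet_integral f i)%E.
Proof.
apply: (@le_trans _ _ (\int[mu \x mu]_(z in unit_disc) sqrE Dn z)%E).
  apply: ge0_subset_integral.
  - exact: measurable_annulus.
  - exact: measurable_unit_disc.
  - by apply: measurable_funTS; exact: (measurable_sqrE mDn).
  - by move=> z _; exact: sqrE_ge0.
  - exact: annulus_sub_disc.
rewrite le_eqVlt; apply/orP; left; apply/eqP.
apply: eq_integral => z zd; rewrite /sqrE /Dn /slice_norm patchE.
by rewrite zd.
Qed.

Lemma annulus_energy_le s s' : 0 <= s <= s' ->
  (\int[mu \x mu]_(z in annulus s') sqrE (slice_norm f i) z <=
   \int[mu \x mu]_(z in annulus s) sqrE (slice_norm f i) z)%E.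
Proof.
move=> /andP[s0 ss']; apply: ge0_subset_integral.
- exact: measurable_annulus.
- exact: measurable_annulus.
- by apply: measurable_funTS; exact: (measurable_sqrE mDn).
- by move=> z _; exact: sqrE_ge0.
- move=> z /andP[z1 z2]; apply/andP; split => //.
  by rewrite (le_lt_trans _ z1)// ler_pXn2r ?nnegrE//; lra.
Qed.

(** Dominated convergence: each point of the disc leaves the annuli of inner radius
    [1 - 1 / (n + 1)] for [n] large, and the Dirichlet integral dominates. *)
Lemma annulus_energy_tail w : 0 < w -> exists2 s, 0 <= s < 1 &
  (\int[mu \x mu]_(z in annulus s) sqrE (slice_norm f i) z <= w%:E)%E.
Proof.
move=> w0.
pose s (n : nat) : R := 1 - n.+1%:R^-1.
pose F (n : nat) := sqrE Dn \_ (annulus (s n)).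
have mF n : measurable_fun setT (F n).
  apply/measurable_restrict => //; first exact: measurable_annulus.
  by apply: measurable_funTS; exact: (measurable_sqrE mDn).
have sc : s n @[n --> \oo] --> (1 : R).
  rewrite -[X in _ --> X]subr0; apply: cvgB; [exact: cvg_cst|exact: cvg_harmonic].
have s2 : s n ^+ 2 @[n --> \oo] --> (1 : R).
  rewrite -(expr1n R 2) !expr2; exact: cvgM.
have F0 z : F ^~ z @ \oo --> 0%E.
  apply: cvg_near_cst.
  have [z1|z1] := ltP (z.1 ^+ 2 + z.2 ^+ 2) 1.
    have [N _ hN] := cvgr_gt _ s2 _ z1; exists N => // n /hN /= zs.
    rewrite /F patchE memNset// => /andP[h _].
    by have := lt_trans h zs; rewrite ltxx.
  apply: nearW => n; rewrite /F patchE memNset// => /andP[_ h].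
  by have := le_lt_trans z1 h; rewrite ltxx.
pose G := sqrE Dn \_ unit_disc.
have mG : measurable_fun setT G.
  apply/measurable_restrict => //; first exact: measurable_unit_disc.
  by apply: measurable_funTS; exact: (measurable_sqrE mDn).
have iG : (mu \x mu)%E.-integrable setT G.
  apply/integrableP; split => //.
  have -> : (\int[mu \x mu]_z `|G z|)%E = dirichlet_integral f i.
    rewrite /dirichlet_integral [RHS]integral_mkcond; apply: eq_integral => z _.
    rewrite /G !patchE; case: ifPn => zd; last by rewrite abse0.
    by rewrite gee0_abs ?sqrE_ge0// /sqrE /Dn /slice_norm patchE zd.
  exact: Efin.
have FG n z : (`|F n z| <= G z)%E.
  rewrite /F /G !patchE; case: ifPn => [/[!inE] zs|_].
    rewrite mem_set; last exact: (annulus_sub_disc zs).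
    by rewrite gee0_abs// sqrE_ge0.
  by rewrite abse0; case: ifP => // _; exact: sqrE_ge0.
have [_ _ cv] := dominated_convergence measurableT mF (measurable_cst 0%E)
  (aeW _ (fun z _ => F0 z)) iG (aeW _ (fun z n _ => FG n z)).
rewrite integral0 in cv.
have /fine_cvgP[[N1 _ h1] cf] := cv; have [N2 _ h2] := cvgr_lt _ cf _ w0.
(* Beyond [N1] the integrals are finite, so that [fine] is faithful; beyond [N2] they are below
   [w]. *)
pose n := maxn N1 N2.
have hn : (\int[mu \x mu]_z F n z <= w%:E)%E.
  have := h2 n (leq_maxr _ _); rewrite /= => /ltW.
  by rewrite -lee_fin fineK//; exact: (h1 n (leq_maxl _ _)).
exists (s n).
  rewrite /s subr_ge0 invf_le1// ler1n/= gtrBl invr_gt0.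
  by rewrite ltr0n.
by rewrite integral_mkcond.
Qed.

(** Cauchy criterion: the squared variation on []1 - d, 1[] is at most [d] times the finite radial
    energy. *)
Lemma radial_cvg k t : (radial_energy (slice_norm f i) 2^-1 t < +oo)%E ->
  cvg (f (r *: qexp i t) 0 k @[r --> 1^'-]).
Proof.
move=> Xfin.
have Xf : radial_energy Dn 2^-1 t \is a fin_num by rewrite ge0_fin_numE// radial_energy_ge0.
set Q := fine (radial_energy Dn 2^-1 t).
have Q0 : 0 <= Q by rewrite fine_ge0// radial_energy_ge0.
apply: cauchy_cvg; apply: cauchy_exP => e e0.
(* The first bound keeps [1 - d] above [1/2], where the radial energy starts; the second gives
   [d * Q < e^2], including when [Q = 0]. *)
pose d : R := Num.min (4^-1) (e ^+ 2 / (2 * (Q + 1))).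
have d0 : 0 < d by rewrite lt_min invr_gt0 ltr0n divr_gt0 ?exprn_gt0 ?mulr_gt0// ltr_wpDl.
have d4 : d <= 4^-1 by rewrite ge_min lexx.
have dQ : d * Q < e ^+ 2.
  have : d * (2 * (Q + 1)) <= e ^+ 2.
    by rewrite -ler_pdivlMr ?mulr_gt0 ?ltr_wpDl// ge_min lexx orbT.
  by nra.
exists (P k (1 - d) t).
have nr : \forall r \near (1 : R)^'-, 1 - d < r < 1.
  near=> r; apply/andP; split; near: r; last exact: nbhs_left_lt.
  by apply: nbhs_left_gt; lra.
move: nr; apply: filterS => r /andP[rd r1].
suff h : (P k r t - P k (1 - d) t) ^+ 2 < e ^+ 2.
  rewrite /ball/= distrC -(@ltr_pXn2r _ 2) ?nnegrE ?normr_ge0 ?(ltW e0)//.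
  by rewrite real_normK ?num_real.
apply: (@le_lt_trans _ _ ((r - (1 - d)) * Q)).
  apply: (radial_sqr_le mDn Dn0 (drP k) (s := 2^-1)) => //; [lra|exact: ltW|].
  by rewrite fineK.
apply: le_lt_trans dQ; rewrite ler_wpM2r//; lra.
Unshelve. all: by end_near. Qed.

Definition trace_set : set T := [set t | (radial_energy (slice_norm f i) 2^-1 t < +oo)%E].

(** Measurable stand-in for a coordinate of [boundary_value]: the default value of [lim] is kept out
    by setting it to 0 off [trace_set]. *)
Definition trace k : T -> R :=
  (fun t => lim (f (r *: qexp i t) 0 k @[r --> 1^'-])) \_ trace_set.

Lemma measurable_trace_set : measurable trace_set.
Proof.
have -> : trace_set = radial_energy Dn 2^-1 @^-1` (~` [set +oo%E]).
  apply/seteqP; split => t /=; rewrite /trace_set/= ltey; first by move/eqP.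
  by move/eqP.
rewrite -[X in measurable X]setTI; apply: (measurable_radial_energy mDn) => //.
by apply: measurableC; exact: emeasurable_set1.
Qed.

Lemma measurable_polar_coord k r : 0 < r < 1 ->
  measurable_fun setT (fun t : T => (f (r *: qexp i t) 0 k : T)).
Proof.
move=> r01; apply: (@continuous_measurable_fun R (P k r)) => t.
apply: differentiable_continuous; apply/derivable1_diffP.
by have [] := dtP k t r01.
Qed.

Lemma trace_cvg k t : trace_set t -> f (r *: qexp i t) 0 k @[r --> 1^'-] --> trace k t.
Proof. by move=> Ct; rewrite /trace patchE mem_set//; exact: radial_cvg. Qed.

Lemma measurable_trace k : measurable_fun setT (trace k : T -> T).
Proof.
(* The shift by two keeps [r 0] positive, as the polar estimates require. *)
pose r (n : nat) : R := 1 - n.+2%:R^-1.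
have rn n : 0 < r n < 1.
  by rewrite /r subr_gt0 invf_lt1// ltr1n/= gtrBl invr_gt0 ltr0n.
apply: (@measurable_fun_cvg _ _ _ _ (fun n => (fun t => P k (r n) t : T) \_ trace_set)).
  move=> n; apply/measurable_restrict => //; first exact: measurable_trace_set.
  by apply: measurable_funTS; exact: measurable_polar_coord.
move=> t _; have [Ct|nCt] := pselect (trace_set t); last first.
  rewrite /trace patchE memNset//.
  by under eq_fun do rewrite patchE memNset//; exact: cvg_cst.
have /cvg_at_leftP/(_ r) := @trace_cvg k t Ct.
under [X in _ -> X @ _ --> _]eq_fun do rewrite patchE mem_set//.
apply; split; first by move=> n; case/andP: (rn n).
rewrite -[X in _ --> X]subr0; apply: cvgB; first exact: cvg_cst.
by have := @cvg_harmonic R; rewrite -cvg_shiftS.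
Qed.

Lemma boundary_value_trace k t : trace_set t -> boundary_value f i t 0 k = trace k t.
Proof.
move=> Ct; have cv : f (r *: qexp i t) @[r --> 1^'-] --> \row_j trace j t.
  by apply: cvg_row => j; rewrite mxE; exact: trace_cvg.
have -> : boundary_value f i t = \row_j trace j t.
  by apply: cvg_lim; [exact: norm_hausdorff|exact: cv].
by rewrite mxE.
Qed.

End trace.

(** * Oscillation of boundary values and Hardy means *)

Section mean_oscillation_bound.
Context {R : realType}.
Notation mu := (@lebesgue_measure R).
Notation T := (measurableTypeR R).
Variables (f : quaternion R -> quaternion R) (i : quaternion R).
Hypothesis Hf : SH_L f.
Hypothesis iS : im_sphere i.
Hypothesis Efin : (dirichlet_integral f i < +oo)%E.

Let Dn : T * T -> R := slice_norm f i.
Let P k (r t : R) := f (r *: qexp i t) 0 k.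

Let mDn : measurable_fun setT (Dn : T * T -> T).
Proof. exact: measurable_slice_norm. Qed.

Let Dn0 z : 0 <= Dn z. Proof. exact: slice_norm_ge0. Qed.

Let drP k r t : 0 < r < 1 ->
  derivable (P k ^~ t) r 1 /\ `|'D_1 (P k ^~ t) r| <= Dn (polar_map (r, t)).
Proof. exact: derive_polar_r. Qed.

Let dtP k r t : 0 < r < 1 ->
  derivable (P k r) t 1 /\ `|'D_1 (P k r) t| <= Dn (polar_map (r, t)).
Proof. exact: derive_polar_t. Qed.

Let mtr k : measurable_fun setT (trace f i k : T -> R).
Proof. exact: measurable_trace. Qed.

Let trP k t : (radial_energy Dn 2^-1 t < +oo)%E -> P k r t @[r --> 1^'-] --> trace f i k t.
Proof. by move=> h; exact: trace_cvg. Qed.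

Let finE : (\int[mu \x mu]_(z in annulus 2^-1) sqrE Dn z < +oo)%E.
Proof. exact: le_lt_trans (annulus_energy_le_dirichlet Hf iS _) Efin. Qed.

Lemma trace_set_ae (a b : R) : b - a <= 2 * pi -> exists2 N : set T,
  measurable N /\ mu N = 0%E & forall t, a <= t <= b -> ~ N t -> trace_set f i t.
Proof.
move=> ba; have [N [mN N0 NP]] := radial_energy_ae mDn finE ba.
exists N; first by split; [exact: mN|exact: N0].
move=> t tab Nt; apply: contrapT => nC; apply: Nt; apply: NP => /= h; apply: nC.
by apply: h; rewrite /= in_itv.
Qed.

(** The squared modulus is the sum over the four coordinates, each handled by [oscillation_le];
    boundary values are exchanged for the trace both in the mean and in the deviation. *)
Lemma mean_oscillation_le (a b w : R) : a < b -> b - a <= 2 * pi -> 0 < w ->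
  (\int[mu \x mu]_(z in annulus (1 - (b - a) / (4 * pi))) sqrE (slice_norm f i) z
     <= w%:E)%E ->
  (mean_oscillation f i a b <= (4 * ((10 / pi + 320 * pi) * w))%:E)%E.
Proof.
move=> ab ba w0 hw.
have [N [mN N0] NP] := trace_set_ae ba.
have mI : measurable (`]a, b[%classic : set T) by exact: measurable_itv.
have good t : `]a, b[%classic t -> ~ N t -> trace_set f i t.
  by rewrite /= in_itv/= => /andP[/ltW ta /ltW tb]; apply: NP; rewrite ta tb.
pose m k := (b - a)^-1 * Rintegral mu `]a, b[ (trace f i k).
have mE k : boundary_mean f i a b 0 k = m k.
  rewrite /boundary_mean !mxE /m; congr (_ * _); rewrite /Rintegral; congr fine.
  apply: (eq_integral_negligible mI mN N0) => t tI tN.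
  by rewrite boundary_value_trace//; exact: good.
rewrite /mean_oscillation.
have -> : (\int[mu]_(t in `]a, b[)
     (qabs (boundary_value f i t - boundary_mean f i a b) ^+ 2)%:E)%E =
   (\int[mu]_(t in `]a, b[) \sum_(k < 4) ((trace f i k t - m k) ^+ 2)%:E)%E.
  apply: (eq_integral_negligible mI mN N0) => t tI tN.
  rewrite sqr_qabs sumEFin; congr EFin; apply: eq_bigr => k _.
  rewrite mxE [X in _ + X]mxE mE boundary_value_trace//; exact: good.
rewrite ge0_integral_sum//; last 2 first.
- move=> k; apply/measurable_EFinP; apply: measurable_funTS; apply: measurable_funX.
  by apply: measurable_funB.
- by move=> k t _; rewrite lee_fin sqr_ge0.
have l0 : 0 < b - a by rewrite subr_gt0.
rewrite lee_pdivrMl//.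
apply: (@le_trans _ _ (\sum_(k < 4) ((b - a)%:E * ((10 / pi + 320 * pi) * w)%:E))%E).
  apply: lee_sum => k _; rewrite -lee_pdivrMl//.
  exact: (oscillation_le mDn Dn0 (drP k) (dtP k) (mtr k) (@trP k) finE ab ba w0 hw).
under eq_bigr do rewrite -EFinM.
rewrite sumEFin sumr_const card_ord -EFinM lee_fin -[leLHS]mulr_natl.
by rewrite mulrCA.
Qed.

(** [3/4] is a base radius inside []1/2, 1[]: with [u], [v] the values at [r] and [3/4],
    [u^2 <= 2 (u - v)^2 + 2 v^2], and [(u - v)^2] is at most half the radial energy. *)
Lemma coord_sqr_le_radial k (M r t : R) : `|f ((3 / 4) *: qexp i t) 0 k| <= M ->
  2^-1 < r < 1 ->
  ((f (r *: qexp i t) 0 k ^+ 2)%:E <=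
    (2 * M ^+ 2)%:E + radial_energy (slice_norm f i) 2^-1 t)%E.
Proof.
move=> hM /andP[r2 r1].
have [|Xfin] := leP +oo%E (radial_energy Dn 2^-1 t).
  by rewrite leye_eq => /eqP ->; rewrite addey ?leey// -ltNye.
have Xf : radial_energy Dn 2^-1 t \is a fin_num by rewrite ge0_fin_numE// radial_energy_ge0.
rewrite -(fineK Xf) -EFinD lee_fin; set Q := fine _.
have Q0 : 0 <= Q by rewrite fine_ge0// radial_energy_ge0.
have XQ : (radial_energy Dn 2^-1 t <= Q%:E)%E by rewrite fineK.
have hM2 : P k (3 / 4) t ^+ 2 <= M ^+ 2.
  by rewrite -real_normK ?num_real// ler_pXn2r ?nnegrE// (le_trans _ hM).
have d : (P k r t - P k (3 / 4) t) ^+ 2 <= 2^-1 * Q.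
  have [r34|/ltW r34] := leP r (3 / 4).
    rewrite -sqrrN opprB (le_trans (radial_sqr_le
       mDn Dn0 (drP k) (s := 2^-1) _ _ _ _ XQ))//; try lra.
    by rewrite ler_wpM2r//; lra.
  rewrite (le_trans (radial_sqr_le
       mDn Dn0 (drP k) (s := 2^-1) _ _ _ _ XQ))//; try lra.
  by rewrite ler_wpM2r//; lra.
rewrite -[f _ 0 k]/(P k r t); set u := P k r t in d *; set v := P k (3 / 4) t in d hM2.
by have := sqr_ge0 (u - v - v); rewrite !expr2 in d hM2 *; lra.
Qed.

Lemma trace_sqr_le k (M t : R) : `|f ((3 / 4) *: qexp i t) 0 k| <= M ->
  ((trace f i k t ^+ 2)%:E <= (2 * M ^+ 2)%:E + radial_energy (slice_norm f i) 2^-1 t)%E.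
Proof.
move=> hM.
have [|Xfin] := leP +oo%E (radial_energy Dn 2^-1 t).
  by rewrite leye_eq => /eqP ->; rewrite addey ?leey// -ltNye.
have Xf : radial_energy Dn 2^-1 t \is a fin_num by rewrite ge0_fin_numE// radial_energy_ge0.
have h := coord_sqr_le_radial hM.
rewrite -(fineK Xf) -EFinD lee_fin.
have cv : P k r t ^+ 2 @[r --> 1^'-] --> trace f i k t ^+ 2.
  by rewrite expr2; under eq_fun do rewrite expr2; apply: cvgM; exact: trP.
apply: (cvgr_to_le cv).
near=> r.
have r2 : 2^-1 < r by near: r; apply: nbhs_left_gt; lra.
have r1 : r < 1 by near: r; exact: nbhs_left_lt.
by have := h r; rewrite r2 r1 => /(_ isT); rewrite -(fineK Xf) -EFinD lee_fin.
Unshelve. all: by end_near. Qed.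

End mean_oscillation_bound.

(** * Convergence of the Hardy means by domination *)

Section hardy.
Context {R : realType}.
Notation mu := (@lebesgue_measure R).
Notation T := (measurableTypeR R).
Variables (f : quaternion R -> quaternion R) (i : quaternion R) (M : R).
Hypothesis Hf : SH_L f.
Hypothesis iS : im_sphere i.
Hypothesis Efin : (dirichlet_integral f i < +oo)%E.
Hypothesis hM : forall k t, `|f ((3 / 4) *: qexp i t) 0 k| <= M.

Let X t := radial_energy (slice_norm f i) 2^-1 t.
(** Four times the bound of [coord_sqr_le_radial], one for each coordinate; it dominates the squared
    modulus on all circles of radius above [1/2]. *)
Let g t : \bar R := ((8 * M ^+ 2)%:E + 4%:E * X t)%E.

Let X0 t : (0 <= X t)%E. Proof. exact: radial_energy_ge0. Qed.

Let mX : measurable_fun setT (X : T -> \bar R).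
Proof. exact: (measurable_radial_energy (measurable_slice_norm Hf iS)). Qed.

Let mI : measurable (`[0, 2 * pi]%classic : set T).
Proof. exact: measurable_itv. Qed.

Let pi2 : 0 < 2 * pi :> R. Proof. by rewrite mulr_gt0// pi_gt0. Qed.

Let g0 t : (0 <= g t)%E.
Proof. by rewrite adde_ge0// ?mule_ge0// lee_fin mulr_ge0// sqr_ge0. Qed.

Let mg : measurable_fun setT (g : T -> \bar R).
Proof. by apply: emeasurable_funD => //; exact: measurable_funeM. Qed.

Let integral_g : (\int[mu]_(t in `[0%R, (2 * pi)%R]) g t <=
  ((8 * M ^+ 2) * (2 * pi))%:E + 80%:E * dirichlet_integral f i)%E.
Proof.
rewrite ge0_integralD//; last 3 first.
- by move=> t _; rewrite lee_fin mulr_ge0// sqr_ge0.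
- by move=> t _; rewrite mule_ge0.
- by apply: measurable_funTS; exact: measurable_funeM.
have mu2pi : mu `[0, 2 * pi] = (2 * pi)%:E by rewrite lebesgue_itvcc ?subr0// ltW.
rewrite integral_cst// [X in (_ * X + _)%E]mu2pi -EFinM leeD2l//.
rewrite ge0_integralZl//; last exact: measurable_funTS.
have h : (\int[mu]_(t in `[0%R, (2 * pi)%R]) X t <= 20%:E * dirichlet_integral f i)%E.
  apply: (le_trans (integral_radial_energy_le (measurable_slice_norm Hf iS) (lexx _) _)).
    by rewrite subr0.
  by apply: lee_wpmul2l => //; exact: annulus_energy_le_dirichlet.
apply: (le_trans (lee_wpmul2l _ h)) => //.
by rewrite muleA -EFinM (_ : 4 * 20 = 80 :> R)//; ring.
Qed.

Let integrable_g : mu.-integrable `[0, 2 * pi] g.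
Proof.
apply/integrableP; split; first exact: measurable_funTS.
under eq_integral do rewrite gee0_abs//.
apply: (le_lt_trans integral_g).
by rewrite lte_add_pinfty ?ltry// lte_mul_pinfty.
Qed.

Let F (r t : R) : \bar R := (\sum_(k < 4) f (r *: qexp i t) 0 k ^+ 2)%:E.

Let G (t : R) : \bar R := (\sum_(k < 4) trace f i k t ^+ 2)%:E.

Let mF r : 0 < r < 1 -> measurable_fun setT (F r : T -> \bar R).
Proof.
move=> r01; apply/measurable_EFinP; apply: measurable_sum => k.
exact: (measurable_funX _ (measurable_polar_coord Hf iS k r01)).
Qed.

Let mG : measurable_fun setT (G : T -> \bar R).
Proof.
apply/measurable_EFinP; apply: measurable_sum => k.
exact: (measurable_funX _ (measurable_trace Hf iS k)).
Qed.

Let sum_le_g (c : 'I_4 -> R) t :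
  (forall k, (c k ^+ 2)%:E <= (2 * M ^+ 2)%:E + X t)%E ->
  ((\sum_(k < 4) c k ^+ 2)%:E <= g t)%E.
Proof.
move=> h; have [|Xfin] := leP +oo%E (X t).
  by rewrite leye_eq => /eqP Xt; rewrite /g Xt gt0_muley// addey ?leey//.
have Xf : X t \is a fin_num by rewrite ge0_fin_numE.
rewrite /g -(fineK Xf) -EFinM -EFinD lee_fin.
have h' k : c k ^+ 2 <= 2 * M ^+ 2 + fine (X t).
  by rewrite -lee_fin EFinD fineK.
rewrite (le_trans (ler_sum _ (fun k _ => h' k)))// sumr_const card_ord.
by rewrite -[leLHS]mulr_natl; lra.
Qed.

Let F_le r t : 2^-1 < r < 1 -> (`|F r t| <= g t)%E.
Proof.
move=> r01; rewrite gee0_abs; last by rewrite lee_fin sumr_ge0// => k _; exact: sqr_ge0.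
by apply: sum_le_g => k; exact: coord_sqr_le_radial.
Qed.

Let G_le t : (G t <= g t)%E.
Proof. by apply: sum_le_g => k; exact: trace_sqr_le. Qed.

Lemma integral_meanE r : integral_mean f i r =
  (((2 * pi)^-1)%:E * \int[mu]_(t in `[0%R, (2 * pi)%R]) F r t)%E.
Proof.
rewrite /integral_mean; congr (_ * _)%E; apply: eq_integral => t _.
by rewrite sqr_qabs.
Qed.

Definition boundary_energy : \bar R :=
  (((2 * pi)^-1)%:E * \int[mu]_(t in `[0%R, (2 * pi)%R]) G t)%E.

Lemma boundary_energy_le : (boundary_energy <=
  ((2 * pi)^-1)%:E * (((8 * M ^+ 2) * (2 * pi))%:E + 80%:E * dirichlet_integral f i))%E.
Proof.
apply: lee_wpmul2l; first by rewrite lee_fin invr_ge0 ltW.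
apply: le_trans integral_g; apply: ge0_le_integral => //.
- by move=> t _; rewrite lee_fin sumr_ge0// => k _; exact: sqr_ge0.
- exact: measurable_funTS.
- exact: measurable_funTS.
Qed.

Lemma boundary_energy_fin : boundary_energy \is a fin_num.
Proof.
rewrite ge0_fin_numE.
  apply: (le_lt_trans boundary_energy_le).
  rewrite lte_mul_pinfty ?lee_fin ?invr_ge0 ?(ltW pi2)//.
  by rewrite lte_add_pinfty ?ltry// lte_mul_pinfty.
rewrite mule_ge0 ?lee_fin ?invr_ge0 ?(ltW pi2)// integral_ge0// => t _.
by rewrite lee_fin sumr_ge0// => k _; exact: sqr_ge0.
Qed.

Lemma integral_mean_cvg : integral_mean f i r @[r --> 1^'-] --> boundary_energy.
Proof.
rewrite -(fineK boundary_energy_fin); apply/cvge_at_leftP => u [u1 uc].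
rewrite fineK ?boundary_energy_fin//.
have h12 : 2^-1 < 1 :> R by rewrite invf_lt1// ltr1n.
(* Domination holds only for radii above [1/2], so the sequence is shifted past its first [n0]
   terms. *)
have [n0 _ un0] := cvgr_gt _ uc _ h12.
rewrite -(cvg_shiftn n0) /=.
have v1 n : 2^-1 < u (n + n0)%N < 1 by rewrite u1 andbT; apply: un0; exact: leq_addl.
have v0 n : 0 < u (n + n0)%N < 1.
  by have /andP[h1 ->] := v1 n; rewrite andbT (lt_trans _ h1)// invr_gt0.
have vc : u (n + n0)%N @[n --> \oo] --> (1 : R) by rewrite (cvg_shiftn n0).
have vl : u (n + n0)%N @[n --> \oo] --> (1 : R) by [].
under eq_fun do rewrite integral_meanE.
apply: cvgeZl => //.
have pp : 2 * pi - 0 <= 2 * pi :> R by rewrite subr0.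
have [N [mN N0] NP] := trace_set_ae Hf iS Efin pp.
have cF : {ae mu, forall t, `[0, 2 * pi]%classic t -> F (u (n + n0)%N) t @[n --> \oo] --> G t}.
  exists N; split; [exact: mN|exact: N0|move=> t /= Ht].
  apply: contrapT => tN; apply: Ht; rewrite in_itv/= => tI.
  have Ct : trace_set f i t by exact: NP.
  apply: cvg_EFin; first exact: nearW.
  have hk k : f (u (n + n0)%N *: qexp i t) 0 k @[n --> \oo] --> trace f i k t.
    have /cvg_at_leftP := trace_cvg Hf iS (k := k) Ct.
    by apply; split; [move=> n; exact: u1|exact: vc].
  have hk2 k : f (u (n + n0)%N *: qexp i t) 0 k ^+ 2 @[n --> \oo] --> trace f i k t ^+ 2.
    by rewrite expr2; under eq_fun do rewrite expr2; exact: cvgM.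
  have hs : \sum_(k < 4) f (u (n + n0)%N *: qexp i t) 0 k ^+ 2 @[n --> \oo] -->
      \sum_(k < 4) trace f i k t ^+ 2.
    rewrite sum_ord4; under eq_fun do rewrite sum_ord4.
    by apply: cvgD => //; apply: cvgD => //; apply: cvgD.
  exact: hs.
have bF : {ae mu, forall t n, `[0, 2 * pi]%classic t -> (`|F (u (n + n0)%N) t| <= g t)%E}.
  by apply: aeW => t n _; exact: F_le.
have [_ _] := dominated_convergence mI (fun n => measurable_funTS (mF (v0 n)))
  (measurable_funTS mG) cF integrable_g bF.
by [].
Qed.

End hardy.

(** * Bounds uniform in the imaginary unit, and the inclusion *)

(** Compactness of the closed quaternionic ball of radius [3/4]. One [M] serves every imaginary
    unit, as the supremum in [Hardy2] demands. *)
Lemma SH_L_bounded (R : realType) (f : quaternion R -> quaternion R) : SH_L f ->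
  exists M, forall x k, qabs x <= 3 / 4 -> `|f x 0 k| <= M.
Proof.
move=> [df _].
pose A := [set x : quaternion R | \sum_(k < 4) x 0 k ^+ 2 <= (3 / 4) ^+ 2].
have AE x : A x <-> qabs x <= 3 / 4.
  by rewrite /A/= -sqr_qabs ler_pXn2r ?nnegrE ?qabs_ge0//; lra.
have cA : closed A.
  have cs : continuous (fun x : quaternion R => \sum_(k < 4) x 0 k ^+ 2).
    move=> x.
    suff h : (fun y : quaternion R => \sum_(k < 4) y 0 k ^+ 2) @ x -->
        \sum_(k < 4) x 0 k ^+ 2 by exact: h.
    rewrite sum_ord4; under eq_fun do rewrite sum_ord4.
    have ck k : (fun x : quaternion R => x 0 k ^+ 2) @ x --> x 0 k ^+ 2.
      exact: (cvg_comp _ _ (@coord_continuous R _ _ 0 k x) (@exprn_continuous R 2 _)).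
    exact: (cvgD (cvgD (cvgD (ck 0) (ck 1)) (ck 2%:R)) (ck 3%:R)).
  have -> : A = (fun x : quaternion R => \sum_(k < 4) x 0 k ^+ 2) @^-1`
      [set y | y <= (3 / 4) ^+ 2] by [].
  by apply: preimage_closed; [move=> x _; exact: cs|exact: closed_le].
have bA : bounded_set A.
  exists 1; split; first exact: num_real.
  move=> N N1 x /AE xA; rewrite /= (le_trans (norm_le_qabs _))// (le_trans xA)//; lra.
have kA : compact A by exact: bounded_closed_compact.
have cf : {within A, continuous f}.
  apply: continuous_in_subspaceT => x /[!inE] /AE xA.
  by apply: differentiable_continuous; apply: df; rewrite /unit_ball/=; lra.
have [N [_ hN]] := compact_bounded (continuous_compact cf kA).
exists (N + 1) => x k /AE xA.
rewrite (le_trans (coord_le_norm _ _))//.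
by apply: (hN (N + 1)); [rewrite ltrDl|exists x].
Qed.

Lemma Dirichlet_bound (R : realType) (f : quaternion R -> quaternion R) : Dirichlet f ->
  exists2 K : R, 0 <= K & forall i, im_sphere i -> (dirichlet_integral f i <= K%:E)%E.
Proof.
move=> [_]; set S := ereal_sup _ => Sfin.
have hS i : im_sphere i -> (dirichlet_integral f i <= S)%E.
  by move=> iS; apply: ereal_sup_ubound; exists i.
have d0 i : (0 <= dirichlet_integral f i)%E.
  by apply: integral_ge0 => z _; rewrite lee_fin sqr_ge0.
(* [im_unit 0] only witnesses that the sphere is nonempty, so that the supremum is not [-oo]. *)
have S0 : (0 <= S)%E := le_trans (d0 _) (hS _ (im_unit_sphere 0)).
exists (fine S); first exact: fine_ge0.
by move=> i iS; rewrite fineK ?ge0_fin_numE//; exact: hS.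
Qed.

Theorem lemma6p6 (R : realType) : @Dirichlet R `<=` @VMOSH R.
Proof.
move=> f Df; have Hf : SH_L f by case: Df.
have [K K0 hK] := Dirichlet_bound Df.
have Efin i : im_sphere i -> (dirichlet_integral f i < +oo)%E.
  by move=> iS; rewrite (le_lt_trans (hK i iS))// ltry.
have pi0 := pi_gt0 R.
pose C : R := 10 / pi + 320 * pi.
have C0 : 0 < C by rewrite addr_gt0 ?divr_gt0 ?mulr_gt0.
split.
  split.
    have [M hM] := SH_L_bounded Hf.
    have hMi i : im_sphere i -> forall k t, `|f ((3 / 4) *: qexp i t) 0 k| <= M.
      move=> iS k t; apply: hM.
      have h : qabs ((3 / 4) *: qexp i t) ^+ 2 <= (3 / 4) ^+ 2.
        by rewrite polar_slice_point sqr_qabs_slice_point// !exprMn -mulrDr cos2Dsin2 mulr1.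
      by rewrite -(@ler_pXn2r _ 2) ?nnegrE ?qabs_ge0 ?divr_ge0.
    have cv i (iS : im_sphere i) := integral_mean_cvg Hf iS (Efin i iS) (hMi i iS).
    split => //; first by move=> i /cv; exact: cvgP.
    apply: (@le_lt_trans _ _ (((2 * pi)^-1)%:E *
        (((8 * M ^+ 2) * (2 * pi))%:E + 80%:E * K%:E))%E); last first.
      rewrite lte_mul_pinfty ?lee_fin ?invr_ge0 ?mulr_ge0 ?(ltW pi0)//.
      by rewrite lte_add_pinfty ?ltry// lte_mul_pinfty// ltry.
    apply: ge_ereal_sup => _ [i iS <-].
    rewrite (cvg_lim _ (cv i iS)); last exact: ereal_hausdorff.
    apply: (le_trans (boundary_energy_le Hf iS (hMi i iS))).
    apply: lee_wpmul2l; first by rewrite lee_fin invr_ge0 mulr_ge0// ltW.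
    by rewrite leeD2l//; apply: lee_wpmul2l => //; exact: hK.
  (* [K + 1] instead of [K], since the energy bound given to [mean_oscillation_le] has to be
     positive. *)
  apply: (@le_lt_trans _ _ (4 * (C * (K + 1)))%:E); last exact: ltry.
  apply: ge_ereal_sup => _ [i iS <-]; apply: ge_ereal_sup => _ [[a b] /= [ab ba] <-].
  apply: (mean_oscillation_le Hf iS (Efin i iS)) => //; first by rewrite ltr_wpDl.
  apply: (le_trans (annulus_energy_le_dirichlet Hf iS _)).
  by rewrite (le_trans (hK i iS))// lee_fin lerDl.
(* The resulting oscillation bound [4 * (C * w)] is [e / 2]. *)
move=> i iS e e0; pose w := e / (8 * C).
have w0 : 0 < w by rewrite divr_gt0// mulr_gt0.
have [s /andP[s0 s1] hs] := annulus_energy_tail Hf iS (Efin i iS) w0.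
(* For shorter arcs the inner radius [1 - (b - a) / (4 pi)] exceeds [s], so their annulus lies in
   the one of energy at most [w]. *)
exists (4 * pi * (1 - s)); first by rewrite !mulr_gt0 ?subr_gt0.
move=> a b ab ba bad.
apply: (@le_lt_trans _ _ (4 * (C * w))%:E); last first.
  rewrite lte_fin /w (_ : 4 * (C * (e / (8 * C))) = e / 2); first lra.
  by field; rewrite gt_eqF.
apply: (mean_oscillation_le Hf iS (Efin i iS)) => //.
apply: le_trans hs; apply: annulus_energy_le => //; rewrite s0/=.
rewrite lerBrDl -lerBrDr ler_pdivrMr ?mulr_gt0// mulrC.
exact: ltW.
Qed.
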